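(* Every planar graph is $(3,11)$-choosable (in the sense of union separation). That is, if $G$ is a planar graph and $L$ assigns to each vertex $v$ of $G$ a set $L(v)$ with $|L(v)| \geq 3$ for all vertices $v$ and $|L(u) \cup L(v)| \geq 11$ for all edges $uv$ of $G$, then $G$ has an $L$-coloring.
   Context: Graphs are finite and simple. For integers $t \geq k$, a $(k,t)$-list assignment of a graph $G$ (union separation) is a function $L$ assigning to each vertex $v$ a set $L(v)$ of colors such that $|L(v)| \geq k$ for all vertices $v$ and $|L(u)\cup L(v)| \geq t$ for all edges $uv$. An $L$-coloring is an assignment $c$ of colors to the vertices with $c(v) \in L(v)$ for all vertices $v$ and $c(u)\neq c(v)$ for all adjacent $u,v$. A graph is $(k,t)$-choosable if it has an $L$-coloring for every $(k,t)$-list assignment $L$. *)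

(* Defs.v *)
From mathcomp Require Import all_boot all_order all_algebra.
From mathcomp Require Import boolp classical_sets functions cardinality reals.

Set Implicit Arguments.
Unset Strict Implicit.
Unset Printing Implicit Defensive.

Import Order.TTheory GRing.Theory Num.Theory.

Local Open Scope classical_set_scope.
Local Open Scope card_scope.
Local Open Scope ring_scope.

(* A finite simple graph is a symmetric irreflexive [e : rel T] on a finType. *)

(* Planarity is the existence of a crossing-free drawing in the real plane in
   which edges are simple polygonal arcs, as in the textbooks of Diestel and
   West. *)
Section Planarity.
Variable R : realType.
Implicit Types (a b z : 'rV[R]_2) (s : seq 'rV[R]_2).

Definition segment a b : set 'rV[R]_2 :=
  [set z | exists2 t : R, 0 <= t <= 1 & z = (1 - t) *: a + t *: b].

(* The i-th side of the polygonal line with vertex sequence s; it is meaningful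
   for i.+1 < size s only. *)
Definition side s (i : nat) : set 'rV[R]_2 := segment s`_i s`_i.+1.

Definition polyline s : set 'rV[R]_2 :=
  [set z | exists2 i : nat, (i.+1 < size s)%N & side s i z].

(* By uniqueness of the vertices no side is degenerate, so that together with
   the second clause the polygonal line does not meet itself. *)
Definition simple_arc a b s : Prop :=
  [/\ (1 < size s)%N, head 0 s = a, last 0 s = b, uniq s &
      forall (i j : nat) z, (i < j)%N -> (j.+1 < size s)%N ->
        side s i z -> side s j z -> j = i.+1 /\ z = s`_j].

(* [arc u v] is relevant for adjacent u and v only; [arc u v] and [arc v u]
   describe the same edge. *)
Definition plane_drawing (T : finType) (e : rel T)
    (pos : T -> 'rV[R]_2) (arc : T -> T -> seq 'rV[R]_2) : Prop :=
  [/\ injective pos,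
      forall u v, e u v -> simple_arc (pos u) (pos v) (arc u v),
      forall u v, e u v -> arc v u = rev (arc u v),
      forall u v w, e u v -> polyline (arc u v) (pos w) -> w = u \/ w = v &
      forall u v x y z, e u v -> e x y -> [set u; v]%SET != [set x; y]%SET ->
        polyline (arc u v) z -> polyline (arc x y) z ->
        exists2 w : T, z = pos w & w \in [set u; v]%SET :&: [set x; y]%SET].

Definition planar (T : finType) (e : rel T) : Prop :=
  exists (pos : T -> 'rV[R]_2) (arc : T -> T -> seq 'rV[R]_2),
    plane_drawing e pos arc.

End Planarity.

(* Lists are arbitrary, possibly infinite, sets of colors; [`I_n #<= A] says
   that A has at least n elements. *)
Definition list_assignment (k t : nat) (T : finType) (e : rel T)
    (C : Type) (L : T -> set C) : Prop :=
  (forall v, `I_k #<= L v) /\ (forall u v, e u v -> `I_t #<= L u `|` L v).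

Definition list_coloring (T : finType) (e : rel T)
    (C : Type) (L : T -> set C) (c : T -> C) : Prop :=
  (forall v, L v (c v)) /\ (forall u v, e u v -> c u <> c v).

Definition choosable (k t : nat) (T : finType) (e : rel T) : Prop :=
  forall (C : Type) (L : T -> set C),
    list_assignment k t e L -> exists c : T -> C, list_coloring e L c.

(* Main.v *)
Require Import Defs.
From mathcomp Require Import all_boot all_order all_algebra.
From mathcomp Require Import boolp classical_sets functions cardinality reals.
From mathcomp Require Import ring lra zify.

(* Lists are trimmed to at most 11 colors and edges with disjoint lists are
   dropped, so that adjacent lists have total size at least 12. In a minimal
   counterexample every vertex v satisfies 3 <= |L(v)| <= d(v).

   Reducibility: let d(v) <= 10 and let U consist of neighbors u of v of degree
   3 whose other neighbors are all adjacent to v. Color G - v - U. If u in U has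
   a single color left and it lies in L(v), then the colors of
   L(u) \ L(v), at least 11 - |L(v)| in number, are all used on neighbors of v,
   where they do no harm to v. Counting the colors left at v, the coloring
   extends as soon as |U| > d(v) - |L(v)|.

   Discharging: by Euler's formula the charges d(v) - 6 on the vertices and
   2|f| - 6 on the faces have a negative sum. A vertex of degree 3, 4, 5 takes
   1, 1/2, 1/5 from each neighbor, and every face with at least 4 sides gives
   1/2 to each of its corners next to such a vertex. Reducibility bounds what a
   vertex of degree 9 or 10 has to pay, and all final charges are nonnegative.

   Euler's formula (in the form E - V + 1 <= F, with the faces defined from the
   cyclic order of the edges around each vertex) follows once every edge set
   with even degrees is the boundary of a set of faces. The set is found by
   counting modulo 2 the edges crossed by a vertical ray issued from a point
   next to a given edge; this parity does not change along an edge, nor across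
   an angle between consecutive edges at a vertex. *)

Set Implicit Arguments.
Unset Strict Implicit.
Unset Printing Implicit Defensive.

Import Order.TTheory GRing.Theory Num.Theory.

Local Open Scope ring_scope.

(** * Straight-line drawings *)

Lemma F2_addrr (x : 'F_2) : x + x = 0.
Proof. exact: (addrr_pchar2 (pchar_Fp (isT : prime 2))). Qed.

Section StraightLine.
Variables (R : realFieldType) (P : finType) (X Y : P -> R) (E : rel P).
Hypotheses (Xinj : injective X) (Esym : symmetric E) (Eirr : irreflexive E).

(** As [X] is injective, no edge is vertical: pq is the graph of an affine function of the
    abscissa. *)
Definition slope p q : R := (Y q - Y p) / (X q - X p).
Definition height p q (x : R) : R := Y p + slope p q * (x - X p).

Hypothesis noncrossing : forall p q c d x,
  E p q -> E c d -> X p < X q -> X c < X d ->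
  X p <= x <= X q -> X c <= x <= X d -> height p q x = height c d x ->
  (p = c /\ q = d) \/ (exists r, [/\ X r = x, r = p \/ r = q & r = c \/ r = d]).

Lemma slopeC p q : slope p q = slope q p.
Proof. by rewrite /slope -[X q - X p]opprB -[Y q - Y p]opprB invrN mulrNN. Qed.

Lemma height_l p q : height p q (X p) = Y p.
Proof. by rewrite /height subrr mulr0 addr0. Qed.

Lemma height_r p q : X p != X q -> height p q (X q) = Y q.
Proof.
move=> neq; rewrite /height /slope mulfVK ?subrK; first by rewrite addrC subrK.
by rewrite subr_eq0 eq_sym.
Qed.

Lemma heightC p q x : X p != X q -> height p q x = height q p x.
Proof.
move=> neq; have := height_r neq; rewrite /height (slopeC q p) => h.
rewrite -h; ring.
Qed.

Definition overlap p q c d x := (X p <= x <= X q) && (X c <= x <= X d).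

(** The difference of the heights is affine. If it changed sign, it would vanish strictly between x
    and y, at a common point interior to both segments. *)
Lemma height_nocross p q c d x y :
  E p q -> E c d -> X p < X q -> X c < X d ->
  overlap p q c d x -> overlap p q c d y ->
  height p q x < height c d x -> height p q y <= height c d y.
Proof.
move=> Epq Ecd pq cd ox oy hx; rewrite leNgt; apply/negP => hy.
pose g t := height c d t - height p q t.
have gx : 0 < g x by rewrite subr_gt0.
have gy : g y < 0 by rewrite subr_lt0.
(* The zero of [g], interpolated from its values at x and y. *)
pose t := (g x * y - g y * x) / (g x - g y).
have D0 : 0 < g x - g y by lra.
have gt0 : g t = 0.
  have gaff u : g u = g 0 + u * (g 1 - g 0) by rewrite /g /height; ring.
  rewrite (gaff t) /t.
  have -> : (g x * y - g y * x) / (g x - g y) * (g 1 - g 0) =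
            - g 0 by apply: (mulIf (lt0r_neq0 D0)); rewrite mulrAC mulfVK ?lt0r_neq0 //;
                 rewrite (gaff x) (gaff y); ring.
  by rewrite subrr.
have htE : height p q t = height c d t by apply/eqP; rewrite eq_sym -subr_eq0; apply/eqP.
have tD : t * (g x - g y) = g x * y - g y * x by rewrite /t mulfVK ?lt0r_neq0.
have neq : x != y by apply/eqP => exy; move: gx gy; rewrite exy; lra.
have tb : (x < t < y) || (y < t < x).
  have e1 : (t - x) * (g x - g y) = g x * (y - x) by rewrite mulrBl tD; ring.
  have e2 : (y - t) * (g x - g y) = - g y * (y - x) by rewrite mulrBl tD; ring.
  have gy' : 0 < - g y by rewrite oppr_gt0.
  case/orP: (lt_total neq) => l; apply/orP; [left|right].
    rewrite -(subr_gt0 x) -(subr_gt0 t) -(pmulr_lgt0 _ D0) e1 -(pmulr_lgt0 (y - t) D0) e2.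
    by rewrite !mulr_gt0 ?subr_gt0.
  rewrite -subr_lt0 andbC -[t < x]subr_lt0 -(pmulr_llt0 _ D0) e1 -(pmulr_llt0 (y - t) D0) e2.
  by rewrite !pmulr_rlt0 ?subr_lt0 ?l.
move: ox oy => /andP[/andP[px xq] /andP[cx xd]] /andP[/andP[py yq] /andP[cy yd]].
have [pt tq ct td] : [/\ X p < t, t < X q, X c < t & t < X d].
  by case/orP: tb => /andP[? ?]; split; lra.
have := noncrossing Epq Ecd pq cd _ _ htE; rewrite !ltW //.
case=> // [[ep eq]|[r [rt [er|er] _]]].
- by move: hx; rewrite ep eq ltxx.
- by move: pt; rewrite -er rt ltxx.
- by move: tq; rewrite -er rt ltxx.
Qed.

(* An abscissa common to both segments, provided that their interiors overlap
   horizontally; [above] is meaningful in that case only. *)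
Definition midx p q c d : R :=
  (Num.max (X p) (X c) + Num.min (X q) (X d)) / 2.

Definition above p q c d :=
  height p q (midx p q c d) < height c d (midx p q c d).

(** [midx] is interior to both segments, so the heights differ there as well, and [height_nocross]
    carries the comparison from x to [midx]. *)
Lemma above_at p q c d x :
  E p q -> E c d -> X p < X q -> X c < X d -> X p < X d -> X c < X q ->
  overlap p q c d x -> height p q x != height c d x ->
  above p q c d = (height p q x < height c d x).
Proof.
move=> Epq Ecd pq cd pd cq ox neq.
have [ml mr] : Num.max (X p) (X c) < midx p q c d /\ midx p q c d < Num.min (X q) (X d).
  have : Num.max (X p) (X c) < Num.min (X q) (X d).
    by rewrite gt_max !lt_min pq pd cq cd.
  by rewrite /midx => ?; split; lra.
move: ml mr; rewrite gt_max lt_min => /andP[pm cm] /andP[mq md].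
have om : overlap p q c d (midx p q c d) by rewrite /overlap !ltW.
have om' : overlap c d p q (midx p q c d) by rewrite /overlap andbC.
have ox' : overlap c d p q x by rewrite /overlap andbC.
rewrite /above; set m := midx p q c d in om om' pm cm mq md *.
case: (ltgtP (height p q x)) neq => // hx _; last first.
  by apply/negbTE; rewrite -leNgt; apply: height_nocross hx.
rewrite lt_neqAle (height_nocross Epq Ecd pq cd ox om hx) andbT.
apply/eqP => hm; have := noncrossing Epq Ecd pq cd _ _ hm; rewrite !ltW //.
case=> // [[ep eq]|[r [rt [er|er] _]]].
- by move: hx; rewrite ep eq ltxx.
- by move: pm; rewrite -er rt ltxx.
- by move: mq; rewrite -er rt ltxx.
Qed.

Lemma above_left p q d :
  E p q -> E p d -> X p < X q -> X p < X d ->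
  above p q p d = (slope p q < slope p d).
Proof.
move=> Epq Epd pq pd; rewrite /above.
have pm : 0 < midx p q p d - X p.
  have : X p < Num.min (X q) (X d) by rewrite lt_min pq.
  by rewrite /midx maxxx; lra.
by rewrite /height ltrD2l ltr_pM2r.
Qed.

Lemma above_right p q c :
  X q < X p -> X c < X p ->
  above q p c p = (slope p c < slope p q).
Proof.
move=> qp cp; rewrite /above.
have pm : midx q p c p - X p < 0.
  have : Num.max (X q) (X c) < X p by rewrite gt_max qp.
  by rewrite /midx minxx; lra.
rewrite (heightC (p := q)) ?lt_eqF // (heightC (p := c)) ?lt_eqF //.
by rewrite /height ltrD2l ltr_nM2r.
Qed.


(** * Parity of the edges above a segment *)

Section Labels.
Variable z : P -> P -> 'F_2.
Hypotheses (zsym : forall p q, z p q = z q p)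
  (zeven : forall p, \sum_(q | E p q) z p q = 0).

(** The vertical ray starts just above pq, slightly to the right of p: an edge that begins at
    abscissa [X p] counts, one that ends there does not. In [label_above_r] the ray is slightly to
    the left of q. *)
Definition label_above p q : 'F_2 :=
  \sum_(s | [&& E s.1 s.2, X s.1 < X s.2, X s.1 <= X p < X s.2 & above p q s.1 s.2])
    z s.1 s.2.

Definition label_above_r p q : 'F_2 :=
  \sum_(s | [&& E s.1 s.2, X s.1 < X s.2, X s.1 < X q <= X s.2 & above p q s.1 s.2])
    z s.1 s.2.

Lemma above_end p q c d r :
  E p q -> X p < X q -> E c d -> X c < X d -> r = c \/ r = d -> X p < X r < X q ->
  above p q c d = (height p q (X r) < Y r).
Proof.
move=> Epq pq Ecd cd rcd /andP[pr rq].
have hr : height c d (X r) = Y r.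
  by case: rcd => ->; rewrite ?height_l ?height_r // lt_eqF.
have or : overlap p q c d (X r).
  by rewrite /overlap (ltW pr) (ltW rq) /=; case: rcd => ->; rewrite lexx ?andbT ltW.
rewrite -hr; apply: above_at => //.
- by case: rcd => e; rewrite -?e // (lt_trans _ cd) // -e.
- by case: rcd => e; rewrite -?e // (lt_trans cd) // -e.
apply/eqP => h; move: (or) => /andP[op oc].
case: (noncrossing Epq Ecd pq cd op oc h) => [[ep eq]|[r' [/Xinj -> [e|e] _]]].
- by case: rcd pr rq => ->; rewrite ?ep ?eq ltxx.
- by rewrite -e ltxx in pr.
- by rewrite -e ltxx in rq.
Qed.

(* Between the two ends of the segment pq, the edges above pq start or end at
   vertices above pq, and z has even degree at each of them. *)
Lemma label_above_ends p q : E p q -> X p < X q -> label_above p q = label_above_r p q.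
Proof.
move=> Epq pq.
pose F (s : P * P) := z s.1 s.2 * ((E s.1 s.2) && (X s.1 < X s.2))%:R.
(* [B] marks the vertices above pq and strictly between its ends. An edge above pq is crossed by
   exactly one of the two rays when exactly one of its ends is marked. *)
pose B r : 'F_2 := (X p < X r < X q)%R%:R * (height p q (X r) < Y r)%R%:R.
suff h : label_above p q + label_above_r p q = 0.
  by rewrite -[LHS]addr0 -[in LHS](F2_addrr (label_above_r p q)) addrA h add0r.
have -> : label_above p q + label_above_r p q = \sum_s (F s * B s.1 + F s * B s.2).
  rewrite /label_above /label_above_r !(big_mkcond (fun s => [&& _, _, _ & _])) -big_split /=.
  apply: eq_bigr => -[c d] _ /=; rewrite /F /=.
  case Ecd: (E c d); last by rewrite /= !mulr0 !mul0r addr0.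
  case cd: (X c < X d); last by rewrite /= !mulr0 !mul0r addr0.
  rewrite /= mulr1 /B.
  have hB r : r = c \/ r = d -> (X p < X r < X q)%R%:R * (height p q (X r) < Y r)%R%:R
      = (X p < X r < X q)%R%:R * (above p q c d)%:R :> 'F_2.
    move=> rcd; case b: (X p < X r < X q); last by rewrite !mul0r.
    by rewrite (above_end Epq pq Ecd cd rcd b).
  rewrite !hB; [|by right|by left].
  case: (above p q c d); last by rewrite !andbF !mulr0 addr0.
  rewrite !andbT !mulr1.
  have -> b : (if b then z c d else 0) = z c d * b%:R by case: b; rewrite ?mulr1 ?mulr0.
  have -> b : (if b then z c d else 0) = z c d * b%:R by case: b; rewrite ?mulr1 ?mulr0.
  rewrite -!mulrDr; congr (_ * _).
  case: (lerP (X c) (X p)) => cp /=.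
    rewrite (le_lt_trans cp pq) /=.
    case: (ltrP (X p) (X d)) => pd /=; last first.
      by rewrite leNgt (le_lt_trans pd pq) addr0.
    by case: (ltrP (X d) (X q)) => dq /=; rewrite ?addr0 ?add0r // F2_addrr.
  rewrite (lt_trans cp cd) /=.
  case: (ltrP (X c) (X q)) => cq /=; last first.
    by rewrite ltNge (le_trans cq (ltW cd)) addr0.
  by case: (ltrP (X d) (X q)) => dq /=; rewrite ?addr0 ?add0r // F2_addrr.
(* Regrouped by vertices, the coefficient of [B r] is the sum of z around r. *)
have -> : \sum_s (F s * B s.1 + F s * B s.2) =
    \sum_r (\sum_d F (r, d) * B r + \sum_c F (c, r) * B r).
  rewrite !big_split /= [X in _ = _ + X]exchange_big /= !pair_bigA /=.
  by congr (_ + _); apply: eq_bigr => -[].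
apply: big1 => r _.
rewrite -!mulr_suml -mulrDl.
suff -> : \sum_d F (r, d) + \sum_c F (c, r) = 0 by rewrite mul0r.
rewrite -[RHS](zeven r) -big_split [RHS]big_mkcond /=.
apply: eq_bigr => d _; rewrite /F /= (Esym d r).
case Erd: (E r d); last by rewrite !mulr0 addr0.
have : X r != X d by apply: contraTneq Erd => /Xinj ->; rewrite Eirr.
by rewrite (zsym d r); case: ltgtP => // _ _; rewrite mulr1 mulr0 ?addr0 ?add0r.
Qed.

Definition label_base p : 'F_2 :=
  \sum_(s | [&& E s.1 s.2, X s.1 < X p < X s.2 & Y p < height s.1 s.2 (X p)]) z s.1 s.2.

(* Counterclockwise order of the directions at p, starting from the vertical
   downward one. *)
Definition angle_le p d q :=
  ((X p < X d) && ~~ (X p < X q)) ||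
  (((X p < X d) == (X p < X q)) && (slope p d <= slope p q)).

(* The parity, on the left side of the oriented segment pq, of the number of
   edges of z above. *)
Definition label p q : 'F_2 :=
  label_base p + \sum_(d | E p d && (X p < X d)) z p d
  + \sum_(d | E p d && angle_le p d q) z p d.

End Labels.

Lemma angle_le_total p : total (angle_le p).
Proof.
move=> a b; rewrite /angle_le; case: (X p < X a); case: (X p < X b) => //=; exact: le_total.
Qed.

Lemma angle_le_trans p : transitive (angle_le p).
Proof.
move=> b a c; rewrite /angle_le.
by case: (X p < X a); case: (X p < X b); case: (X p < X c) => //=; apply: le_trans.
Qed.

(** Two edges leaving p in the same direction share the nearer of their other ends, which
    [noncrossing] allows only if they are equal. *)
Lemma angle_le_anti p a b : E p a -> E p b -> angle_le p a b -> angle_le p b a -> a = b.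
Proof.
move=> Ea Eb; rewrite /angle_le.
wlog ab : a b Ea Eb / X a <= X b.
  move=> H h1 h2; case: (leP (X a) (X b)) => [|/ltW] l; first exact: H.
  exact/esym/H.
have na : X p != X a by apply: contraTneq Ea => /Xinj ->; rewrite Eirr.
have nb : X p != X b by apply: contraTneq Eb => /Xinj ->; rewrite Eirr.
move: (na) (nb); case: (ltgtP (X p) (X a)) => // pa _; case: (ltgtP (X p) (X b)) => // pb _ //=
  => h1 h2; have es : slope p a = slope p b by apply/eqP; rewrite eq_le h1.
- have he : height p a (X a) = height p b (X a) by rewrite /height es.
  have o1 : X p <= X a <= X a by rewrite lexx ltW.
  have o2 : X p <= X a <= X b by rewrite ab ltW.
  case: (noncrossing Ea Eb pa pb o1 o2 he) => [[]//|[r [/Xinj -> _ [e|e]]]] //.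
  by move: pa; rewrite e ltxx.
- rewrite Esym in Ea; rewrite Esym in Eb.
  have he : height a p (X b) = height b p (X b).
    by rewrite -!(heightC (p := p)) // /height es.
  have o1 : X a <= X b <= X p by rewrite ab ltW.
  have o2 : X b <= X b <= X p by rewrite lexx ltW.
  case: (noncrossing Ea Eb pa pb o1 o2 he) => [[]//|[r [/Xinj -> [e|e] _]]] //.
  by move: pb; rewrite e ltxx.
Qed.

(** An edge over [X p] whose left end is not p misses p, so it is compared with pq at p itself;
    edges with left end p are compared by slope. *)
Lemma label_aboveE z p q : E p q -> X p < X q ->
  label_above z p q = label_base z p +
    \sum_(d | [&& E p d, X p < X d & slope p q < slope p d]) z p d.
Proof.
move=> Epq pq; rewrite /label_above (bigID (fun s => s.1 == p)) /= addrC; congr (_ + _).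
  apply: eq_bigl => -[c d] /=; case Ecd: (E c d) => //=.
  have -> : (X c < X p) = (X c <= X p) && (c != p).
    by rewrite lt_neqAle (inj_eq Xinj) andbC.
  case: eqP => [->|/eqP ncp]; first by rewrite !andbF.
  rewrite !andbT; case cp: (X c <= X p) => /=; last by rewrite !andbF.
  case pd: (X p < X d) => /=; last by rewrite !andbF.
  have cp' : X c < X p by rewrite lt_neqAle cp (inj_eq Xinj) ncp.
  have cd := lt_trans cp' pd; rewrite cd /=.
  have o : overlap p q c d (X p) by rewrite /overlap lexx !ltW.
  rewrite -(height_l p q); apply: above_at => //; first exact: lt_trans pq.
  apply/eqP => h; move: (o) => /andP[op oc].
  case: (noncrossing Epq Ecd pq cd op oc h) => [[ep _]|[r [/Xinj -> _ [e|e]]]].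
  - by rewrite ep eqxx in ncp.
  - by rewrite -e eqxx in ncp.
  - by rewrite e ltxx in pd.
rewrite (reindex_onto (fun d => (p, d)) snd) /=; last by move=> [c d] /= /andP[_ /eqP->].
apply: eq_bigl => d; rewrite !eqxx !andbT lexx /=.
case Epd: (E p d) => //=; case pd: (X p < X d) => //=.
by rewrite above_left.
Qed.

Lemma label_above_rE (z : P -> P -> 'F_2) p q :
  (forall p q, z p q = z q p) -> E p q -> X p < X q ->
  label_above_r z p q = label_base z q +
    \sum_(d | [&& E q d, X d < X q & slope q d < slope q p]) z q d.
Proof.
move=> zsym Epq pq; rewrite /label_above_r (bigID (fun s => s.2 == q)) /= addrC; congr (_ + _).
  apply: eq_bigl => -[c d] /=; case Ecd: (E c d) => //=.
  have -> : (X q < X d) = (X q <= X d) && (d != q).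
    by rewrite lt_neqAle eq_sym (inj_eq Xinj) andbC.
  case: eqP => [->|/eqP ndq]; first by rewrite !andbF.
  rewrite !andbT; case dq: (X q <= X d) => /=; last by rewrite !andbF.
  case cq: (X c < X q) => /=; last by rewrite !andbF.
  have dq' : X q < X d by rewrite lt_neqAle dq eq_sym (inj_eq Xinj) ndq.
  have cd := lt_trans cq dq'; rewrite cd /=.
  have o : overlap p q c d (X q) by rewrite /overlap lexx !ltW.
  rewrite -(height_r (p := p) (q := q)) ?lt_eqF //.
  apply: above_at => //; first exact: lt_trans dq'.
  apply/eqP => h; move: (o) => /andP[op oc].
  case: (noncrossing Epq Ecd pq cd op oc h) => [[_ eq]|[r [/Xinj -> _ [e|e]]]].
  - by rewrite eq eqxx in ndq.
  - by rewrite e ltxx in cq.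
  - by rewrite e eqxx in ndq.
rewrite (reindex_onto (fun d => (d, q)) fst) /=; last by move=> [c d] /= /andP[_ /eqP->].
rewrite (eq_bigr (fun d => z q d)); last by move=> d _; exact: zsym.
apply: eq_bigl => d; rewrite !eqxx !andbT lexx andbT /= (Esym d).
case Epd: (E q d) => //=; case pd: (X d < X q) => //=.
by rewrite above_right // (slopeC q p).
Qed.

(** For [X p < X q] the left side of pq is the upper one and that of qp the lower one: the labels
    are [label_above], and [label_above_r] plus the weight of the edge itself, crossed when starting
    from below. *)
Lemma label_opp (z : P -> P -> 'F_2) p q :
  (forall p q, z p q = z q p) -> (forall p, \sum_(q | E p q) z p q = 0) ->
  E p q -> label z p q + label z q p = z p q.
Proof.
move=> zsym zeven.
wlog pq : p q / X p < X q.
  move=> H Epq; have : X p != X q by apply: contraTneq Epq => /Xinj ->; rewrite Eirr.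
  case: ltgtP => // l _; first exact: H.
  by rewrite addrC zsym; apply: H => //; rewrite Esym.
move=> Epq.
have Eqp : E q p by rewrite Esym.
have nqd d : E q d -> X q != X d by apply: contraTneq => /Xinj ->; rewrite Eirr.
have hl : label z p q = label_above z p q.
  rewrite label_aboveE // /label -addrA; congr (_ + _).
  (* The edges to the right of slope at most [slope p q] occur twice and cancel; the steeper ones
     remain. *)
  rewrite (bigID (fun d => slope p d <= slope p q) (fun d => E p d && _)) /= addrAC.
  set S := \sum_(i | _ && _) _; set S' := \sum_(i | E p i && angle_le _ _ _) _.
  have -> : S' = S.
    by apply: eq_bigl => d; rewrite /angle_le pq andbF /= eqb_id andbA.
  rewrite F2_addrr add0r; apply: eq_bigl => d.
  by rewrite -ltNge andbA.
have hr : label z q p = label_above_r z p q + z p q.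
  rewrite label_above_rE // /label -!addrA; congr (_ + _).
  (* At q, all edges to the right precede p in the angular order, so they occur twice and cancel. *)
  rewrite [X in _ + X = _](bigID (fun d => X q < X d)) /= addrA.
  set S := \sum_(i | _ && _) _; set S' := \sum_(i | (E q i && angle_le _ _ _) && _) _.
  have -> : S' = S.
    apply: eq_bigl => d; rewrite /angle_le (lt_gtF pq) /=.
    by case: (X q < X d); rewrite ?andbT ?andbF.
  rewrite F2_addrr add0r (bigD1 p) /=; last first.
    by rewrite Eqp /angle_le (lt_gtF pq) /= lexx.
  rewrite addrC zsym; congr (_ + _); apply: eq_bigl => d.
  rewrite /angle_le (lt_gtF pq) /=; case Eqd: (E q d) => //=.
  have := nqd _ Eqd; case: ltgtP => // qd _; rewrite ?andbF //= andbT lt_neqAle andbC.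
  congr (_ && _); apply/idP/idP; first last.
    by apply: contraNneq => ->.
  apply: contraNneq => es; apply/eqP; apply: (@angle_le_anti q) => //;
    by rewrite /angle_le (lt_gtF pq) (lt_gtF qd) /= es lexx.
by rewrite hl hr (label_above_ends zsym zeven) // addrA F2_addrr add0r.
Qed.

End StraightLine.

(** * Faces of a rotation system *)

Section FaceMap.
Variables (T : finType) (e : rel T) (rot : T -> seq T).
Hypotheses (e_sym : symmetric e) (e_irr : irreflexive e).

Definition rotation := forall u, uniq (rot u) /\ (forall v, (v \in rot u) = e u v).

(** A face is an orbit of this map. When [rot] is counterclockwise, the walk takes the rightmost
    turn and keeps the face on its right. *)
Definition face_map (x : T * T) : T * T := (x.2, next (rot x.2) x.1).

Definition darts := [pred x : T * T | e x.1 x.2].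

(* [k u v] is the value, on the face to the right of the dart uv, of a set of
   faces with boundary [z]. *)
Definition face_labels := forall z : T -> T -> 'F_2,
  (forall u v, z u v = z v u) -> (forall u, \sum_(v | e u v) z u v = 0) ->
  exists k : T -> T -> 'F_2,
    (forall u v, e u v -> k u v + k v u = z u v) /\
    (forall u v, e u v -> k v u = k u (next (rot u) v)).

Hypothesis rotP : rotation.

Lemma face_map_inj : injective face_map.
Proof.
move=> [a b] [c d] [/= <-] h; congr (_, _).
by rewrite -(prev_next (rotP b).1 a) h prev_next // (rotP b).1.
Qed.

Lemma face_map_dart x : darts (face_map x) = darts x.
Proof. by rewrite /= -(rotP x.2).2 mem_next (rotP x.2).2 e_sym. Qed.

(** Over F_2, the kernel of the incidence matrix [B] is the cycle space, of dimension at least E - V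
    + 1. By [face_labels] it lies in the row space of the face-edge incidence matrix [M], of
    dimension at most F. *)
Lemma euler : face_labels -> (0 < #|T|)%N ->
  (#|darts| + 2 <= 2 * (#|T| + fcard face_map darts))%N.
Proof.
move=> labels T0.
pose Ed := [set x | darts x && (enum_rank x.1 < enum_rank x.2)%N]%SET.
pose swap (x : T * T) := (x.2, x.1).
have swapK : involutive swap by case.
have swap_Ed x : x \in Ed -> swap x \notin Ed.
  by rewrite !finset.inE /= => /andP[_ l]; rewrite negb_and -leqNgt (ltnW l) orbT.
have dart_Ed x : darts x = (x \in Ed) || (swap x \in Ed).
  rewrite !finset.inE /= e_sym; case exy : (e x.2 x.1) => //=.
  have : x.1 != x.2 by apply: contraTneq exy => ->; rewrite e_irr.
  by rewrite -(inj_eq enum_rank_inj) -val_eqE neq_ltn.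
have cardD : (#|darts| = #|Ed| + #|Ed|)%N.
  have -> : #|darts| = #|(swap @: Ed :|: Ed)%SET|.
    apply: eq_card => x; rewrite finset.in_setU -[LHS]/(darts x) dart_Ed orbC; congr (_ || _).
    by rewrite -{2}[x]swapK (finset.mem_imset _ _ (can_inj swapK)).
  have dis : (swap @: Ed :&: Ed)%SET = finset.set0.
    apply/finset.setP => x; rewrite finset.in_setI finset.in_set0; apply/negbTE/andP => -[].
    by move=> /imsetP[y yE ->]; apply/negP/swap_Ed.
  by rewrite cardsU dis cards0 subn0 card_imset //; apply: can_inj swapK.
pose Fs := [set x | (x \in froots face_map) && (x \in darts)]%SET.
have cardF : fcard face_map darts = #|Fs|.
  by rewrite /n_comp_mem; apply: eq_card => x; rewrite !finset.inE.
pose d (i : 'I_#|Ed|) := enum_val i.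
have dE i : d i \in Ed by exact: enum_valP.
pose B : 'M['F_2]_(#|Ed|, #|T|) :=
  \matrix_(i, j) ((enum_val j == (d i).1)%:R + (enum_val j == (d i).2)%:R).
pose M : 'M['F_2]_(#|Fs|, #|Ed|) :=
  \matrix_(r, i) ((enum_val r == froot face_map (d i))%:R +
                  (enum_val r == froot face_map (swap (d i)))%:R).
have sum_eq (I : finType) (f : I -> 'F_2) (a : I) : \sum_i f i * (i == a)%:R = f a.
  rewrite (bigD1 a) //= eqxx mulr1 big1 ?addr0 // => i /negbTE->; exact: mulr0.
have sum_ev (I : finType) (A : {pred I}) (f : I -> 'F_2) (a : I) : a \in A ->
    \sum_(i < #|A|) f (enum_val i) * (enum_val i == a)%:R = f a.
  move=> aA; rewrite -(big_enum_val (fun i => f i * (i == a)%:R)).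
  by rewrite (bigD1 a) //= eqxx mulr1 big1 ?addr0 // => i /andP[_ /negbTE->]; exact: mulr0.
(* Each row of [B] has two entries 1, so [B] kills the all-ones column. *)
have rB : (\rank B < #|T|)%N.
  have B1 : B *m const_mx 1 = 0 :> 'cV_#|Ed|.
    apply/matrixP => i j; rewrite !mxE.
    under eq_bigr do rewrite !mxE mulr1 -[_ + _]mul1r mulrDr.
    have h a : \sum_(i < #|T|) 1 * (enum_val i == a)%:R = 1 :> 'F_2.
      exact: (sum_ev _ T (fun=> 1) a).
    by rewrite big_split /= !h F2_addrr.
  have := mulmx0_rank_max B1; suff : (0 < \rank (const_mx 1%R : 'cV['F_2]_#|T|))%N by lia.
  rewrite lt0n mxrank_eq0; apply/eqP => /matrixP/(_ (Ordinal T0) ord0).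
  by rewrite !mxE.
suff /mxrankS : (kermx B <= M)%MS.
  rewrite mxrank_ker; have := rank_leq_row M; rewrite cardF cardD; lia.
apply/row_subP => r; set w := row r _.
have wB : w *m B = 0 by rewrite -row_mul mulmx_ker row0.
pose z u v := \sum_i w 0 i * (((u, v) == d i)%:R + ((v, u) == d i)%:R).
have zsym u v : z u v = z v u by apply: eq_bigr => i _; rewrite addrC.
have zE i : z (d i).1 (d i).2 = w 0 i.
  have nswap j : (((d i).2, (d i).1) == d j) = false.
    by apply: contraTF (swap_Ed _ (dE i)) => /eqP h; rewrite /swap h negbK.
  rewrite /z -surjective_pairing (bigD1 i) // eqxx nswap.
  rewrite addr0 mulr1 big1 => [|j ji]; first exact: addr0.
  rewrite (inj_eq enum_val_inj) eq_sym (negbTE ji) add0r.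
  by rewrite nswap mulr0.
have zeven u : \sum_(v | e u v) z u v = 0.
  have -> : \sum_(v | e u v) z u v = \sum_v z u v.
    rewrite [LHS]big_mkcond; apply: eq_bigr => v _; case: ifPn => // neuv.
    rewrite /z big1 // => i _; have := dE i; rewrite finset.inE => /andP[/= ei _].
    have /negbTE -> : (u, v) != d i by apply: contraNneq neuv => h; rewrite -h in ei.
    have /negbTE -> : (v, u) != d i.
      by apply: contraNneq neuv => h; rewrite -h /= e_sym in ei.
    by rewrite addr0 mulr0.
  rewrite exchange_big /= -[RHS](_ : (w *m B) 0 (enum_rank u) = 0); last by rewrite wB mxE.
  rewrite mxE; apply: eq_bigr => i _; rewrite [B _ _]mxE enum_rankK -mulr_sumr big_split /=.
  congr (_ * (_ + _)).
    rewrite -[RHS](sum_eq _ (fun v => (u == (d i).1)%:R) (d i).2).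
    by apply: eq_bigr => v _; rewrite [d i]surjective_pairing xpair_eqE -mulnb natrM.
  rewrite -[RHS](sum_eq _ (fun v => (u == (d i).2)%:R) (d i).1).
  by apply: eq_bigr => v _; rewrite [d i]surjective_pairing xpair_eqE andbC -mulnb natrM.
have [k [kE kF]] := labels z zsym zeven.
(* [k] is constant on faces; its values at the roots of the orbits are the coefficients that express
   w by the rows of [M]. *)
pose k' (x : T * T) := if darts x then k x.1 x.2 else 0.
have k'root x : k' (froot face_map x) = k' x.
  symmetry. apply: (fconnect_invariant (f := face_map)); last exact: connect_root.
  move=> y; rewrite /= /k' face_map_dart; case: ifP => //= ey.
  by rewrite -kF ?eqxx // e_sym.
have k'K x : darts x ->
    \sum_(r < #|Fs|) k' (enum_val r) * (enum_val r == froot face_map x)%:R = k' x.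
  move=> dx; rewrite -(k'root x) sum_ev // finset.inE; apply/andP; split.
    exact: (roots_root (fconnect_sym face_map_inj)).
  have cl : fclosed face_map darts.
    by move=> a b /eqP <-; rewrite -!topredE /= -[LHS]/(darts a) -face_map_dart.
  by have := closed_connect cl (connect_root _ x); rewrite -!topredE /= => <-.
apply/submxP; exists (\row_r k' (enum_val r)); apply/rowP => i.
rewrite [RHS]mxE; under eq_bigr do rewrite [M _ _]mxE [X in X * _]mxE mulrDr.
have di : darts (d i) by have := dE i; rewrite finset.inE => /andP[].
have dsi : darts (swap (d i)) by rewrite /= e_sym.
by rewrite big_split /= !k'K // /k' di dsi /= kE ?zE.
Qed.

End FaceMap.

(** * Polygonal drawings *)

Lemma next_cat (T : eqType) (s1 s2 : seq T) v :
  uniq (s1 ++ v :: s2) -> next (s1 ++ v :: s2) v = head (head v s1) s2.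
Proof.
move=> us; rewrite next_nth mem_cat mem_head orbT.
have nv : v \notin s1 by move: us; rewrite -cat_rcons cat_uniq rcons_uniq => /andP[/andP[]].
case: s1 nv {us} => [|y s1] /=; first by rewrite eqxx nth0.
rewrite inE negb_or eq_sym => /andP[/negbTE -> nv].
by rewrite index_cat (negbTE nv) /= eqxx addn0 nth_cat ltnNge leqnSn /= subSnn /= nth0.
Qed.

(** Passing to the successor adds one term to the prefix sum. From the last element to the first, it
    goes from the total, which is zero, to the first term. *)
Lemma cyclic_prefix_sums (T : eqType) (le : rel T) (s : seq T) (f : T -> 'F_2) v :
  transitive le -> reflexive le -> (forall a b, a \in s -> b \in s -> le a b -> le b a -> a = b) ->
  sorted le s -> uniq s -> \sum_(x <- s) f x = 0 -> v \in s ->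
  \sum_(x <- s | le x v) f x = \sum_(x <- s | le x (next s v)) f x + f (next s v).
Proof.
move=> tr rf anti so us tot vs.
have pref s1 a s2 : s = s1 ++ a :: s2 -> \sum_(x <- s | le x a) f x = \sum_(x <- rcons s1 a) f x.
  move=> es; have : pairwise le s by rewrite -sorted_pairwise.
  rewrite es pairwise_cat /= allrel_consr -cat_rcons => /and4P[/andP[al _] _ ar _].
  rewrite big_cat /= [X in _ + X]big_seq_cond [X in _ + X]big_pred0; last first.
    move=> x; apply/negbTE/andP => -[xs xa].
    have ax := allP ar _ xs; have ex : x = a.
      by apply: anti => //; rewrite es mem_cat inE ?xs ?eqxx ?orbT.
    by move: us; rewrite es cat_uniq /= -ex xs /= !andbF.
  rewrite addr0 big_seq_cond [RHS]big_seq; apply: eq_bigl => x.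
  rewrite mem_rcons inE; case: eqP => [->|_] /=; first exact: rf.
  by case xs: (x \in s1) => //=; exact: (allP al).
have [s1 [s2 es]] : exists s1 s2, s = s1 ++ v :: s2.
  by case/splitPr: vs => s1 s2; exists s1, s2.
have nx : next s v = head (head v s1) s2 by rewrite es next_cat // -es.
rewrite nx (pref _ _ _ es).
case: s2 es {nx} => [|n s2] /= es.
  rewrite cats1 in es; rewrite -es tot.
  case: s1 es => [|y s1] /= es.
    by rewrite (pref [::] v [::]) //= big_seq1 F2_addrr.
  by rewrite (pref [::] y (rcons s1 v)) //= big_seq1 F2_addrr.
rewrite (pref (rcons s1 v) n s2); last by rewrite cat_rcons.
by rewrite -[rcons (rcons s1 v) n]cats1 big_cat big_seq1 -addrA F2_addrr addr0.
Qed.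

(** Each pair of distinct points excludes at most one value of [lam], and the chosen one exceeds all
    of these in absolute value. The shear makes every side of the drawing nonvertical. *)
Lemma separating_direction (R : realFieldType) (s : seq 'rV[R]_2) :
  exists lam : R, {in s &, injective (fun z : 'rV[R]_2 => z 0 0 + lam * z 0 1)}.
Proof.
pose bad := [seq (p.1 0 0 - p.2 0 0) / (p.2 0 1 - p.1 0 1) | p : 'rV[R]_2 * 'rV[R]_2 <- [seq (a, b) | a <- s, b <- s]].
pose lam : R := 1 + \sum_(x <- bad) `|x|.
have nbad : lam \notin bad.
  apply/negP => lb; have : `|lam| <= \sum_(x <- bad) `|x|.
    by rewrite (big_rem _ lb) /= lerDl sumr_ge0.
  have := ler_norm lam; rewrite {1 3}/lam; lra.
exists lam => a b sa sb /= h.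
have hy : a 0 1 = b 0 1.
  apply/eqP; apply: contraNT nbad => ne; apply/mapP; exists (a, b).
    by apply/allpairsP; exists (a, b).
  have ne' : b 0 1 - a 0 1 != 0 by rewrite subr_eq0 eq_sym.
  by rewrite /=; apply: (mulIf ne'); rewrite mulfVK //; lra.
apply/rowP => i; case: i => -[|[|//]] hi.
  have -> : Ordinal hi = 0 by apply: val_inj.
  by move: h; rewrite hy; lra.
by have -> : Ordinal hi = 1 by apply: val_inj.
Qed.

(** * Vertices and sides of polygonal arcs *)

Section SimpleArc.
Variable R : realType.
Implicit Types (a b z : 'rV[R]_2) (s : seq 'rV[R]_2).

Definition consec a b s :=
  [exists i : 'I_(size s), [&& (i.+1 < size s)%N, s`_i == a & s`_i.+1 == b]].

Lemma consecP a b s :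
  reflect (exists i, [/\ (i.+1 < size s)%N, s`_i = a & s`_i.+1 = b]) (consec a b s).
Proof.
apply: (iffP existsP) => [[i /and3P[h /eqP ? /eqP ?]]|[i [h <- <-]]]; first by exists i.
by exists (Ordinal (ltnW h)); rewrite /= h !eqxx.
Qed.

Lemma consec_nth s i : (i.+1 < size s)%N -> consec s`_i s`_i.+1 s.
Proof. by move=> h; apply/consecP; exists i. Qed.

Lemma nth_injV s i j : uniq s -> (i < size s)%N -> (j < size s)%N -> s`_i = s`_j -> i = j.
Proof. by move=> us hi hj /eqP; rewrite nth_uniq // => /eqP. Qed.

Lemma nth_revV s i : (i < size s)%N -> (rev s)`_i = s`_(size s - i.+1).
Proof. exact: nth_rev. Qed.

Lemma consec_rev a b s : consec a b (rev s) = consec b a s.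
Proof.
have H a' b' s' : consec b' a' s' -> consec a' b' (rev s').
  move=> /consecP[i [h <- <-]]; apply/consecP; exists (size s' - i.+2)%N.
  split; first by rewrite size_rev; lia.
    by rewrite nth_revV; [congr nth; lia|lia].
  by rewrite nth_revV; [congr nth; lia|lia].
by apply/idP/idP => /H //; rewrite revK.
Qed.

Lemma segmentC a b z : segment a b z -> segment b a z.
Proof.
move=> [t /andP[t0 t1] ->]; exists (1 - t); first by apply/andP; split; lra.
by rewrite addrC; congr (_ *: _ + _ *: _); ring.
Qed.

Lemma segment_l a b : segment a b a.
Proof. by exists 0; rewrite ?lexx ?ler01 // subr0 scale1r scale0r addr0. Qed.

Lemma segment_r a b : segment a b b.
Proof. exact/segmentC/segment_l. Qed.

Lemma polyline_nth s i : (1 < size s)%N -> (i < size s)%N -> polyline s s`_i.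
Proof.
move=> s1 si; case: (ltnP i.+1 (size s)) => h; first by exists i => //; exact: segment_l.
case: i si h => [|i] si h; first by lia.
by exists i => //; exact: segment_r.
Qed.

Lemma simple_arc_nth0 a b s : simple_arc a b s -> s`_0 = a.
Proof. by case=> _ <- _ _ _; rewrite nth0. Qed.

Lemma simple_arc_last a b s : simple_arc a b s -> s`_(size s).-1 = b.
Proof. by case=> _ _ <- _ _; rewrite nth_last; case: s. Qed.

(** An end of the arc lies on its first or last side, which meets any other side at most in a shared
    vertex. *)
Lemma simple_arc_end a b s i z : simple_arc a b s -> (i.+1 < size s)%N -> side s i z ->
  z = a \/ z = b -> z = s`_i \/ z = s`_i.+1.
Proof.
move=> sa h zi [za|zb].
  case: i h zi => [|i] h zi; first by left; rewrite (simple_arc_nth0 sa).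
  have z0 : side s 0 z by rewrite za -(simple_arc_nth0 sa); exact: segment_l.
  by case: sa => _ _ _ _ /(_ 0%N i.+1 z isT h z0 zi) [_]; left.
case: (ltnP i.+2 (size s)) => h2; last first.
  by right; rewrite zb -(simple_arc_last sa); congr nth; lia.
pose j := (size s).-2.
have hj : (j.+1 < size s)%N by rewrite /j; lia.
have ej : j.+1 = (size s).-1 by rewrite /j; lia.
have zj : side s j z by rewrite /side zb -(simple_arc_last sa) -ej; exact: segment_r.
case: (sa) => _ _ _ us /(_ i j z _ hj zi zj); case; first by rewrite /j; lia.
move=> _ ezj; have := nth_injV us (ltnW hj) hj; rewrite -ezj ej (simple_arc_last sa).
by move=> /(_ zb); rewrite /j; lia.
Qed.

End SimpleArc.

Section Drawing.
Variables (R : realType) (T : finType) (e : rel T).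
Hypotheses (e_sym : symmetric e) (e_irr : irreflexive e).
Variables (pos : T -> 'rV[R]_2) (arc : T -> T -> seq 'rV[R]_2).
Hypothesis drawing : plane_drawing e pos arc.

Lemma arc_simple u v : e u v -> simple_arc (pos u) (pos v) (arc u v).
Proof. by case: drawing => _ H _ _ _; exact: H. Qed.

Lemma arc_size u v : e u v -> (1 < size (arc u v))%N.
Proof. by move=> /arc_simple[]. Qed.

Lemma arc_uniq u v : e u v -> uniq (arc u v).
Proof. by move=> /arc_simple[]. Qed.

Lemma arc_rev u v : e u v -> arc v u = rev (arc u v).
Proof. by case: drawing => _ _ H _ _; exact: H. Qed.

Lemma pos_inj : injective pos.
Proof. by case: drawing. Qed.

Lemma pos_on_arc u v w i : e u v -> (i < size (arc u v))%N -> (arc u v)`_i = pos w ->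
  (i = 0%N /\ w = u) \/ (i = (size (arc u v)).-1 /\ w = v).
Proof.
move=> uv hi ew; have su := arc_simple uv; have us := arc_uniq uv.
have s1 := arc_size uv.
have := polyline_nth s1 hi; rewrite ew; case: drawing => _ _ _ H _ /(H _ _ _ uv)[wu|wv].
  left; split=> //; apply: (nth_injV us) => //; first exact: ltnW.
  by rewrite ew (simple_arc_nth0 su) wu.
right; split=> //; apply: (nth_injV us) => //; first by lia.
by rewrite ew (simple_arc_last su) wv.
Qed.

Lemma arc_meet u v x y z : e u v -> e x y -> [set u; v]%SET != [set x; y]%SET ->
  polyline (arc u v) z -> polyline (arc x y) z ->
  exists w, [/\ z = pos w, w = u \/ w = v & w = x \/ w = y].
Proof.
move=> uv xy ne pz pz'; case: drawing => _ _ _ _ H.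
have [w zw] := H _ _ _ _ _ uv xy ne pz pz'.
by rewrite !inE => /andP[/orP h1 /orP h2]; exists w; split=> //;
  [case: h1|case: h2] => /eqP; auto.
Qed.

Lemma dart_set_eq (u v x y : T) : [set u; v]%SET = [set x; y]%SET -> (x = u /\ y = v) \/ (x = v /\ y = u) \/ u = v.
Proof.
move=> h; have H t : (t == u) || (t == v) = (t == x) || (t == y).
  have : (t \in [set u; v]%SET) = (t \in [set x; y]%SET) by rewrite h.
  by rewrite !finset.inE.
have := H x; have := H y; have := H u; have := H v; rewrite !eqxx /= !orbT.
move=> /esym/orP vv /esym/orP uu /orP yy /orP xx.
case: xx => /eqP ex; case: yy => /eqP ey; subst x y; auto.
- by case: vv => /eqP ->; auto.
- by case: uu => /eqP ->; auto.
Qed.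

(** Arcs of distinct edges meet at the position of a common vertex, which is an end of both sides by
    [simple_arc_end]. Within one edge the arc is simple; sides with exchanged ends come from the
    reversed arc. *)
Lemma sides_meet u v x y i j z :
  e u v -> e x y -> (i.+1 < size (arc u v))%N -> (j.+1 < size (arc x y))%N ->
  side (arc u v) i z -> side (arc x y) j z ->
  [\/ (arc u v)`_i = (arc x y)`_j /\ (arc u v)`_i.+1 = (arc x y)`_j.+1,
      (arc u v)`_i = (arc x y)`_j.+1 /\ (arc u v)`_i.+1 = (arc x y)`_j |
      (z = (arc u v)`_i \/ z = (arc u v)`_i.+1) /\ (z = (arc x y)`_j \/ z = (arc x y)`_j.+1)].
Proof.
move=> uv xy hi hj zi zj.
have same k : (k.+1 < size (arc u v))%N -> side (arc u v) k z ->
    i = k \/ (z = (arc u v)`_i \/ z = (arc u v)`_i.+1) /\ (z = (arc u v)`_k \/ z = (arc u v)`_k.+1).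
  move=> hk zk; case: (ltngtP i k) => l; [right|right|by left].
    case: (arc_simple uv) => _ _ _ _ /(_ i k z l hk zi zk) [-> ->]; auto.
  case: (arc_simple uv) => _ _ _ _ /(_ k i z l hi zk zi) [-> ->]; auto.
case: (eqVneq [set u; v]%SET [set x; y]%SET) => [es|ne]; last first.
  have pi : polyline (arc u v) z by exists i.
  have pj : polyline (arc x y) z by exists j.
  have [w [zw wuv wxy]] := arc_meet uv xy ne pi pj.
  constructor 3; split.
    apply: (simple_arc_end (arc_simple uv) hi zi).
    by rewrite zw; case: wuv => ->; auto.
  apply: (simple_arc_end (arc_simple xy) hj zj).
  by rewrite zw; case: wxy => ->; auto.
case: (dart_set_eq es) => [[ex ey]|[[ex ey]|euv]]; last by rewrite euv e_irr in uv.
  rewrite ex ey in hj zj *.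
  by case: (same j hj zj) => [->|?]; [constructor 1|constructor 3].
rewrite ex ey in hj zj *; rewrite (arc_rev uv) size_rev in hj zj *.
pose k := (size (arc u v) - j.+2)%N.
have e1 : (rev (arc u v))`_j = (arc u v)`_k.+1.
  by rewrite nth_revV; [congr nth; rewrite /k; lia|lia].
have e2 : (rev (arc u v))`_j.+1 = (arc u v)`_k.
  by rewrite nth_revV; [congr nth; rewrite /k; lia|lia].
rewrite /side e1 e2 in zj *.
have hk : (k.+1 < size (arc u v))%N by rewrite /k; lia.
case: (same k hk (segmentC zj)) => [->|[? ?]]; first by constructor 2.
by constructor 3; split; tauto.
Qed.

End Drawing.

(** * Subdivision into a straight-line drawing *)

Section DrawingLabels.
Variables (R : realType) (T : finType) (e : rel T).
Hypotheses (e_sym : symmetric e) (e_irr : irreflexive e).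
Variables (pos : T -> 'rV[R]_2) (arc : T -> T -> seq 'rV[R]_2).
Hypothesis drawing : plane_drawing e pos arc.

(* The point 0 only serves as a default value. *)
Definition points : seq 'rV[R]_2 := 0 :: flatten [seq arc x.1 x.2 | x <- enum (darts e)].

Definition point (z : 'rV[R]_2) : seq_sub points :=
  insubd (SeqSub (mem_head 0 _ : 0 \in points)) z.

Lemma pointK z : z \in points -> val (point z) = z.
Proof. exact: insubdK. Qed.

Lemma arc_points u v z : e u v -> z \in arc u v -> z \in points.
Proof.
move=> uv zs; rewrite inE; apply/orP; right; apply/flatten_mapP.
by exists (u, v); rewrite // mem_enum.
Qed.

Lemma pointE u v i : e u v -> (i < size (arc u v))%N ->
  val (point (arc u v)`_i) = (arc u v)`_i.
Proof. by move=> uv hi; rewrite pointK //; apply: (arc_points uv); apply: mem_nth. Qed.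

Variable lam : R.
Let x_ (z : 'rV[R]_2) := z 0 0 + lam * z 0 1.
Let y_ (z : 'rV[R]_2) := z 0 1.
Hypothesis x_inj : {in points &, injective x_}.

Let X (p : seq_sub points) := x_ (val p).
Let Y (p : seq_sub points) := y_ (val p).

(** The adjacency of the subdivided graph, whose edges are the sides of all arcs. *)
Definition side_rel (p q : seq_sub points) :=
  [exists x, darts e x && consec (val p) (val q) (arc x.1 x.2)].

Local Notation E := side_rel.

Lemma side_relP p q : reflect
  (exists u v i, [/\ e u v, (i.+1 < size (arc u v))%N, (arc u v)`_i = val p &
                     (arc u v)`_i.+1 = val q]) (E p q).
Proof.
apply: (iffP existsP) => [[[u v] /andP[uv /consecP[i [h1 h2 h3]]]]|[u [v [i [uv h1 h2 h3]]]]].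
  by exists u, v, i.
by exists (u, v); apply/andP; split=> //; apply/consecP; exists i.
Qed.

Lemma X_inj : injective X.
Proof. by move=> p q h; apply/val_inj/x_inj => //; apply: valP. Qed.

Lemma E_sym : symmetric E.
Proof.
have H p q : E p q -> E q p.
  move=> /existsP[[u v] /andP[/= uv c]]; apply/existsP; exists (v, u).
  by rewrite /= e_sym uv (arc_rev drawing uv) consec_rev.
by move=> p q; apply/idP/idP; apply: H.
Qed.

Lemma E_irr : irreflexive E.
Proof.
move=> p; apply/negbTE/side_relP => -[u [v [i [uv hi h1 h2]]]].
have := nth_injV (arc_uniq drawing uv) (ltnW hi) hi; rewrite h1 h2 => /(_ erefl); lia.
Qed.

Lemma xy_inj z z' : x_ z = x_ z' -> y_ z = y_ z' -> z = z'.
Proof.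
rewrite /x_ /y_ => h hy; apply/rowP => i; case: i => -[|[|//]] hi.
  have -> : Ordinal hi = 0 by apply: val_inj.
  by move: h; rewrite hy; lra.
by have -> : Ordinal hi = 1 by apply: val_inj.
Qed.

Lemma segment_height p q x : X p < X q -> X p <= x <= X q ->
  exists z, [/\ segment (val p) (val q) z, x_ z = x & y_ z = height X Y p q x].
Proof.
move=> pq /andP[px xq]; pose t := (x - X p) / (X q - X p).
have d0 : 0 < X q - X p by lra.
have tx : t * (X q - X p) = x - X p by rewrite /t mulfVK ?gt_eqF.
exists ((1 - t) *: val p + t *: val q); split.
- exists t => //; apply/andP; split; first by apply: divr_ge0; lra.
  by rewrite ler_pdivrMr // mul1r; lra.
- have -> : x_ ((1 - t) *: val p + t *: val q) = X p + t * (X q - X p).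
    by rewrite /X /x_ !mxE; ring.
  by rewrite tx; ring.
- have -> : y_ ((1 - t) *: val p + t *: val q) = Y p + t * (Y q - Y p).
    by rewrite /Y /y_ !mxE; ring.
  by rewrite /height /slope mulrAC -mulrA -/t mulrC.
Qed.

(** Equal heights give a common point of two sides, and [sides_meet] applies. Sides with exchanged
    ends cannot both run from left to right. *)
Lemma E_noncrossing p q c d x :
  E p q -> E c d -> X p < X q -> X c < X d ->
  X p <= x <= X q -> X c <= x <= X d -> height X Y p q x = height X Y c d x ->
  (p = c /\ q = d) \/ (exists r, [/\ X r = x, r = p \/ r = q & r = c \/ r = d]).
Proof.
move=> /side_relP[u [v [i [uv hi h1 h2]]]] /side_relP[a [b [j [ab hj h3 h4]]]] pq cd.
move=> /(segment_height pq)[z [zs zx zy]] /(segment_height cd)[z' [zs' zx' zy']] hh.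
have ezz : z' = z by apply: xy_inj; rewrite ?zx ?zx' // zy zy' hh.
have si : side (arc u v) i z by rewrite /side h1 h2.
have sj : side (arc a b) j z by rewrite /side h3 h4 -ezz.
case: (sides_meet e_irr drawing uv ab hi hj si sj); rewrite h1 h2 h3 h4.
- by case=> /val_inj -> /val_inj ->; left.
- by case=> /val_inj ep /val_inj eq; move: pq; rewrite ep eq => /(lt_trans cd); rewrite ltxx.
- case=> hp hc; right; have [r er] : exists r : seq_sub points, z = val r by case: hp => ->; [exists p|exists q].
  exists r; split; first by rewrite /X -er.
    by move: hp; rewrite er; case=> /val_inj ->; auto.
  by move: hc; rewrite er; case=> /val_inj ->; auto.
Qed.

(** A side shared by two edges would have both its ends at common vertices, so the edges would have
    the same ends. The reversed arc traverses the side the other way. *)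
Lemma consec_dart u v a b i :
  e u v -> e a b -> (i.+1 < size (arc u v))%N ->
  consec (arc u v)`_i (arc u v)`_i.+1 (arc a b) -> a = u /\ b = v.
Proof.
move=> uv ab hi c; have us := arc_uniq drawing uv.
case: (eqVneq [set u; v]%SET [set a; b]%SET) => [es|ne].
  case: (dart_set_eq es) => [//|[[ea eb]|euv]]; last by rewrite euv e_irr in uv.
  move: c; rewrite ea eb (arc_rev drawing uv) consec_rev => /consecP[m [hm /esym h1 /esym h2]].
  have := nth_injV us hi (ltnW hm) h1; have := nth_injV us (ltnW hi) hm h2; lia.
move: c => /consecP[m [hm h1 h2]].
have s1 := arc_size drawing uv; have s1' := arc_size drawing ab.
have p1 : polyline (arc a b) (arc u v)`_i by rewrite -h1; apply: polyline_nth => //; lia.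
have p2 : polyline (arc a b) (arc u v)`_i.+1 by rewrite -h2; apply: polyline_nth.
have [w [ew w1 w2]] := arc_meet drawing uv ab ne (polyline_nth s1 (ltnW hi)) p1.
have [w' [ew' w1' w2']] := arc_meet drawing uv ab ne (polyline_nth s1 hi) p2.
have ww : w != w'.
  by apply/eqP => h; have := nth_injV us (ltnW hi) hi; rewrite ew ew' h => /(_ erefl); lia.
move/eqP: ww => ww; case/eqP: ne.
case: w1 => [e1|e1]; case: w2 => [e2|e2]; case: w1' => [e3|e3]; case: w2' => [e4|e4];
  first [by case: ww; congruence | rewrite -e1 -e2 -e3 -e4 //; exact: finset.setUC].
Qed.

Section Cycle.
Variable z : T -> T -> 'F_2.
Hypotheses (zsym : forall u v, z u v = z v u)
  (zeven : forall u, \sum_(v | e u v) z u v = 0).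

(** By [consec_dart] at most one dart contributes. *)
Definition side_weight (p q : seq_sub points) : 'F_2 :=
  \sum_(x | darts e x && consec (val p) (val q) (arc x.1 x.2)) z x.1 x.2.

Lemma side_weight_arc u v i : e u v -> (i.+1 < size (arc u v))%N ->
  side_weight (point (arc u v)`_i) (point (arc u v)`_i.+1) = z u v.
Proof.
move=> uv hi; rewrite /side_weight !pointE // ?(ltnW hi) //.
rewrite (big_pred1 (u, v)) // => -[a b]; apply/idP/eqP => [/andP[/= ab c]|[-> ->]].
  by have [-> ->] := consec_dart uv ab hi c.
by rewrite /= uv consec_nth.
Qed.

Lemma side_weightC p q : side_weight p q = side_weight q p.
Proof.
pose swap (x : T * T) := (x.2, x.1); have swapK : involutive swap by case.
rewrite /side_weight (reindex_inj (inv_inj swapK)) /=.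
apply: eq_big => [[u v]|[u v] _] /=; last exact: zsym.
rewrite e_sym; case uv : (e u v) => //=.
by rewrite (arc_rev drawing uv) consec_rev.
Qed.

Lemma side_weight_even p : \sum_(q | E p q) side_weight p q = 0.
Proof.
transitivity (\sum_q side_weight p q).
  rewrite big_mkcond; apply: eq_bigr => q _; case: ifPn => // /existsPn h.
  by rewrite /side_weight big_pred0 // => x; apply/negbTE/h.
rewrite /side_weight (exchange_big_dep (darts e)) /=; last by move=> q x _ /andP[].
(* A dart contributes once if its arc passes through p or starts there, and not if it ends there. *)
transitivity (\sum_(x | darts e x && ((val p \in arc x.1 x.2) && (val p != pos x.2)))
    z x.1 x.2).
  rewrite [RHS]big_mkcondr; apply: eq_bigr => -[u v] /= uv; rewrite uv /=.
  have su := arc_simple drawing uv; have us := arc_uniq drawing uv.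
  case: ifPn => [/andP[ps pl]|npl].
    have hp := nth_index 0 ps; set i := index _ _ in hp.
    have hi : (i < size (arc u v))%N by rewrite index_mem.
    have hi1 : (i.+1 < size (arc u v))%N.
      rewrite ltn_neqAle hi andbT; apply: contraNneq pl => h.
      by rewrite -hp -(simple_arc_last su) -h.
    rewrite (big_pred1 (point (arc u v)`_i.+1)) // => q; apply/consecP/eqP.
      move=> [m [hm h1 h2]]; apply: val_inj; rewrite pointE //.
      have <- : m = i by apply: (nth_injV us (ltnW hm) hi); rewrite h1 hp.
      exact: esym h2.
    by move=> ->; exists i; split=> //; rewrite [RHS]pointE.
  rewrite big_pred0 // => q; apply/negbTE; apply: contra npl.
  move=> /consecP[m [hm h1 h2]]; rewrite -h1 mem_nth ?(ltnW hm) //=.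
  apply/eqP => h; have := nth_injV us (ltnW hm) _; rewrite h -(simple_arc_last su).
  by move=> /(_ (size (arc u v)).-1 _ erefl); lia.
(* If p is the position of w, the darts leaving w remain and [zeven] applies. At a bend of an arc
   its two darts cancel. Otherwise no dart is left. *)
case: (pickP (fun w => pos w == val p)) => [w /eqP pw|np].
  rewrite -[RHS](zeven w).
  transitivity (\sum_(x | darts e x && (x.1 == w)) z x.1 x.2).
    apply: eq_bigl => -[u v] /=; case uv: (e u v) => //=.
    apply/andP/eqP => [[ps pl]|euw].
      have hi : (index (val p) (arc u v) < size (arc u v))%N by rewrite index_mem.
      have := pos_on_arc drawing uv hi; rewrite nth_index // -pw => /(_ w erefl).
      by case=> [[_ ->]//|[_ wv]]; rewrite -pw wv eqxx in pl.
    subst u; have su := arc_simple drawing uv.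
    rewrite -pw (inj_eq (pos_inj drawing)); split.
      by rewrite -(simple_arc_nth0 su) mem_nth // ltnW // (arc_size drawing uv).
    by apply: contraTneq uv => ->; rewrite e_irr.
  transitivity (\sum_(u | u == w) \sum_(v | e u v) z u v); last by rewrite big_pred1_eq.
  by rewrite pair_big_dep; apply: eq_bigl => x; rewrite andbC.
have np' w : pos w <> val p by move/eqP; rewrite np.
case: (pickP (fun x => darts e x && (val p \in arc x.1 x.2))) => [[u v] /andP[/= uv ps]|none].
  have ps' : val p \in arc v u by rewrite (arc_rev drawing uv) mem_rev.
  have ne w : val p != pos w by apply/eqP => h; apply: (np' w).
  have vu : e v u by rewrite e_sym.
  have nuv : (v, u) != (u, v) by apply: contraTneq uv => -[-> _]; rewrite e_irr.
  rewrite (bigD1 (u, v)) /= ?uv ?ps ?ne // (bigD1 (v, u)) /= ?vu ?ps' ?ne ?nuv //.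
  rewrite big1 ?addr0; first by rewrite (zsym v) F2_addrr.
  move=> [a b] /andP[/andP[/andP[/= ab /andP[pab _]] n1] n2].
  have onl c d : e c d -> val p \in arc c d -> polyline (arc c d) (val p).
    move=> cd pcd; rewrite -(nth_index 0 pcd); apply: polyline_nth.
      exact: (arc_size drawing cd).
    by rewrite index_mem.
  case: (eqVneq [set u; v]%SET [set a; b]%SET) => [es|nes].
    case: (dart_set_eq es) => [[ea eb]|[[ea eb]|euv]]; last by rewrite euv e_irr in uv.
      by rewrite ea eb eqxx in n1.
    by rewrite ea eb eqxx in n2.
  have [w [ew _ _]] := arc_meet drawing uv ab nes (onl _ _ uv ps) (onl _ _ ab pab).
  by case: (np' w).
rewrite big_pred0 // => x; have := none x.
by case: (darts e x) => //= ->.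
Qed.

Local Notation lab := (label X Y E side_weight).
Local Notation ale := (angle_le X Y).

Lemma lab_opp p q : E p q -> lab p q + lab q p = side_weight p q.
Proof.
exact: (label_opp X_inj E_sym E_irr E_noncrossing side_weightC side_weight_even).
Qed.

(** Only two sides issue from a bend p, towards a and b, with equal weights. The labels of pa and pb
    differ by this weight, and so do those of pa and ap. *)
Lemma lab_bend u v i : e u v -> (i.+2 < size (arc u v))%N ->
  lab (point (arc u v)`_i) (point (arc u v)`_i.+1) =
  lab (point (arc u v)`_i.+1) (point (arc u v)`_i.+2).
Proof.
move=> uv hi2; have hi1 := ltnW hi2; have hi := ltnW hi1.
have us := arc_uniq drawing uv.
set a := point (arc u v)`_i; set p := point (arc u v)`_i.+1; set b := point (arc u v)`_i.+2.
have va : val a = (arc u v)`_i by rewrite pointE.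
have vp : val p = (arc u v)`_i.+1 by rewrite pointE.
have vb : val b = (arc u v)`_i.+2 by rewrite pointE.
have nab : a != b.
  apply/eqP => h; have := nth_injV us hi hi2; rewrite -va -vb h => /(_ erefl); lia.
have Eap : E a p by apply/side_relP; exists u, v, i; rewrite va vp.
have Epb : E p b by apply/side_relP; exists u, v, i.+1; rewrite vb vp.
have Epa : E p a by rewrite E_sym.
have Ep d : E p d = (d == a) || (d == b).
  apply/idP/idP => [/side_relP[x [y [m [xy hm h1 h2]]]]|/orP[]/eqP-> //].
  have s1 := arc_size drawing uv; have s1' := arc_size drawing xy.
  case: (eqVneq [set u; v]%SET [set x; y]%SET) => [es|nes]; last first.
    have p1 : polyline (arc x y) (arc u v)`_i.+1.
      by rewrite -vp -h1; apply: polyline_nth => //; lia.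
    have [w [ew _ _]] := arc_meet drawing uv xy nes (polyline_nth s1 hi1) p1.
    by case: (pos_on_arc drawing uv hi1 ew) => -[]; lia.
  have c : consec (val p) (val d) (arc x y) by apply/consecP; exists m.
  case: (dart_set_eq es) => [[ex ey]|[[ex ey]|euv]]; last by rewrite euv e_irr in uv.
    move: c; rewrite ex ey => /consecP[n [hn]]; rewrite vp => e1 e2.
    have en := nth_injV us (ltnW hn) hi1 e1.
    by apply/orP; right; apply/eqP/val_inj; rewrite vb -en e2.
  move: c; rewrite ex ey (arc_rev drawing uv) consec_rev => /consecP[n [hn e2]].
  rewrite vp => e1; have [en] := nth_injV us hn hi1 e1.
  by apply/orP; left; apply/eqP/val_inj; rewrite va -en e2.
have wa : side_weight p a = z u v by rewrite side_weightC side_weight_arc.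
have wb : side_weight p b = z u v by rewrite side_weight_arc.
have S Q : \sum_(d | E p d && Q d) side_weight p d = z u v * (Q a)%:R + z u v * (Q b)%:R.
  rewrite big_mkcondr /= (bigD1 a) /= ?Epa // (bigD1 b) /= ?Epb 1?eq_sym ?nab //.
  rewrite big1 ?addr0 => [|d /andP[/andP[]]]; last by rewrite Ep => /orP[]/eqP->; rewrite eqxx.
  by rewrite wa wb; case: (Q a); case: (Q b); rewrite ?mulr1 ?mulr0.
have -> : lab a p = lab p a + z u v.
  by rewrite -wa -(lab_opp Epa) addrA F2_addrr add0r.
rewrite /label !S -!addrA; congr (_ + (_ + (_ + _))).
have rf q : ale p q q by have := angle_le_total X Y p q q; rewrite orbb.
rewrite !rf !mulr1; case hab: (ale p a b); case hba: (ale p b a).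
- by move: nab; rewrite (angle_le_anti X_inj E_sym E_irr E_noncrossing Epa Epb hab hba) eqxx.
- by rewrite mulr1 mulr0 add0r.
- by rewrite mulr1 mulr0 add0r F2_addrr addr0.
- by have := angle_le_total X Y p a b; rewrite hab hba.
Qed.

Lemma lab_arc u v i : e u v -> (i.+1 < size (arc u v))%N ->
  lab (point (arc u v)`_i) (point (arc u v)`_i.+1) =
  lab (point (arc u v)`_0) (point (arc u v)`_1).
Proof.
by move=> uv; elim: i => // i IH hi; rewrite -lab_bend // IH // ltnW.
Qed.

Definition first_point u v := point (arc u v)`_1.

(** By [lab_arc] the label is constant along the arc, so it can be read on the first side. *)
Definition dart_label u v := lab (point (pos u)) (first_point u v).

Lemma dart_label_opp u v : e u v -> dart_label u v + dart_label v u = z u v.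
Proof.
move=> uv; have vu : e v u by rewrite e_sym.
have s1 := arc_size drawing uv.
(* The index of the last side, which reversed is the first side of [arc v u]. *)
pose k := (size (arc u v)).-2.
have hk : (k.+1 < size (arc u v))%N by rewrite /k; lia.
have -> : dart_label u v = lab (point (arc u v)`_k) (point (arc u v)`_k.+1).
  by rewrite lab_arc // (simple_arc_nth0 (arc_simple drawing uv)).
have -> : dart_label v u = lab (point (arc u v)`_k.+1) (point (arc u v)`_k).
  rewrite /dart_label /first_point (arc_rev drawing uv) nth_revV //.
  rewrite -(simple_arc_last (arc_simple drawing uv)).
  by congr (lab (point _) (point _)); congr nth; rewrite /k; lia.
rewrite lab_opp ?side_weight_arc //.
by apply/side_relP; exists u, v, k; rewrite !pointE // ltnW.
Qed.

(** The guard excludes isolated vertices: their positions need not belong to [points], and [point]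
    would return its default value. *)
Lemma pos_rel w d : reflect (exists2 v, e w v & d = first_point w v) 
  (E (point (pos w)) d && [exists v, e w v]).
Proof.
apply: (iffP andP) => [[/side_relP[x [y [m [xy hm h1 h2]]]] /existsP[v0 wv0]]|[v wv ->]].
  have vw : val (point (pos w)) = pos w.
    by rewrite -(simple_arc_nth0 (arc_simple drawing wv0)) pointE // ltnW ?(arc_size drawing).
  rewrite vw in h1; case: (pos_on_arc drawing xy (ltnW hm) h1) => -[em ew]; last by lia.
  subst x m; exists y => //; apply: val_inj; rewrite /first_point [RHS]pointE //.
split; last by apply/existsP; exists v.
apply/side_relP; exists w, v, 0%N.
have s1 := arc_size drawing wv.
by rewrite -(simple_arc_nth0 (arc_simple drawing wv)) !pointE // ltnW.
Qed.

Lemma first_point_inj w u v : e w u -> e w v -> first_point w u = first_point w v -> u = v.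
Proof.
move=> wu wv h; have su := arc_size drawing wu; have sv := arc_size drawing wv.
apply/eqP; apply: contraT => uv.
have nes : [set w; u]%SET != [set w; v]%SET.
  apply/eqP => /dart_set_eq [[_ e1]|[[e1 e2]|e1]].
  - by rewrite e1 eqxx in uv.
  - by rewrite e1 e_irr in wu.
  - by rewrite e1 e_irr in wu.
have hh : (arc w u)`_1 = (arc w v)`_1 by rewrite -pointE // -[RHS]pointE // -/(first_point w u) h.
have p2 : polyline (arc w v) (arc w u)`_1 by rewrite hh; apply: polyline_nth.
have [t [et t1 t2]] := arc_meet drawing wu wv nes (polyline_nth su su) p2.
have tw : t = w by case: t1 t2 uv => -> [] // ->; rewrite eqxx.
rewrite tw -(simple_arc_nth0 (arc_simple drawing wu)) in et.
by have := nth_injV (arc_uniq drawing wu) su (ltnW su) et.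
Qed.

Definition drawing_le w u v := ale (point (pos w)) (first_point w u) (first_point w v).

Definition drawing_rot w := sort (drawing_le w) (enum (e w)).

Lemma drawing_rot_perm w : perm_eq (drawing_rot w) (enum (e w)).
Proof. exact: permEl (perm_sort _ _). Qed.

Lemma drawing_rotation : rotation e drawing_rot.
Proof. by move=> u; split=> [|v]; rewrite /drawing_rot ?sort_uniq ?enum_uniq ?mem_sort ?mem_enum. Qed.

(** Only the last term depends on v; it is a prefix sum in the cyclic order at w. *)
Lemma dart_label_sum w v : e w v ->
  dart_label w v = label_base X Y E side_weight (point (pos w)) +
    \sum_(d | E (point (pos w)) d && (X (point (pos w)) < X d)) side_weight (point (pos w)) d +
    \sum_(u <- drawing_rot w | drawing_le w u v) z w u.
Proof.
move=> wv; rewrite /dart_label /label; congr (_ + _).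
pose A := first_point w @: [set u | e w u]%SET.
transitivity (\sum_(d in A | ale (point (pos w)) d (first_point w v)) side_weight (point (pos w)) d).
  apply: eq_bigl => d; congr (_ && _).
  have ew : [exists v, e w v] by apply/existsP; exists v.
  apply/idP/imsetP => [Ed|[u]].
    have /pos_rel[u wu ->] : E (point (pos w)) d && [exists v, e w v] by rewrite Ed.
    by exists u; rewrite ?finset.inE.
  by rewrite finset.inE => wu ->; have /andP[] := introT (pos_rel w (first_point w u)) (ex_intro2 _ _ u wu erefl).
rewrite big_mkcondr big_imset /=; last first.
  by move=> a b; rewrite !finset.inE; exact: first_point_inj.
rewrite (perm_big _ (drawing_rot_perm w)) /=.
rewrite big_enum_cond /= big_mkcondr /=; apply: eq_big => [u|u]; rewrite finset.inE // => wu.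
rewrite /drawing_le; case: ifP => // _.
rewrite -(side_weight_arc wu (arc_size drawing wu)).
by rewrite (simple_arc_nth0 (arc_simple drawing wu)).
Qed.

(** From v to its successor n the prefix sum changes by [z w n], which is also the difference
    between the labels of wn and nw. *)
Lemma dart_label_next w v : e w v ->
  dart_label w v = dart_label (next (drawing_rot w) v) w.
Proof.
move=> wv; have [ur mr] := drawing_rotation w.
set n := next _ _; have wn : e w n by rewrite -mr mem_next mr.
have -> : dart_label n w = dart_label w n + z w n.
  by rewrite -(dart_label_opp wn) addrA F2_addrr add0r.
rewrite !dart_label_sum // -[RHS]addrA; congr (_ + _).
apply: cyclic_prefix_sums => //.
- by move=> a b c; apply: angle_le_trans.
- by move=> a; have := angle_le_total X Y (point (pos w)) (first_point w a) (first_point w a); rewrite orbb.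
- move=> a b; rewrite !mr => wa wb h1 h2; apply: (first_point_inj wa wb).
  apply: (angle_le_anti X_inj E_sym E_irr E_noncrossing _ _ h1 h2).
    by have /andP[] := introT (pos_rel w (first_point w a)) (ex_intro2 _ _ a wa erefl).
  by have /andP[] := introT (pos_rel w (first_point w b)) (ex_intro2 _ _ b wb erefl).
- by apply: sort_sorted => a b; apply: angle_le_total.
- by rewrite (perm_big _ (drawing_rot_perm w)) big_enum zeven.
- by rewrite mr.
Qed.

End Cycle.

Lemma drawing_face_labels : face_labels e drawing_rot.
Proof.
(* [dart_label] refers to the left side of a dart and [face_labels] to the right side, hence the
   exchange. *)
move=> z zsym zeven; exists (fun u v => dart_label z v u); split=> u v uv.
  by rewrite addrC dart_label_opp.
exact: dart_label_next.
Qed.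

End DrawingLabels.

Lemma planar_face_labels (R : realType) (T : finType) (e : rel T) :
  symmetric e -> irreflexive e -> planar R e ->
  exists rot, rotation e rot /\ face_labels e rot.
Proof.
move=> e_sym e_irr [pos [arc drawing]].
have [lam x_inj] := separating_direction (points e arc).
exists (drawing_rot e pos arc lam); split; first exact: drawing_rotation.
exact: drawing_face_labels.
Qed.

Local Close Scope ring_scope.

(** * Discharging *)

Lemma next_neq (T : eqType) (s : seq T) x : uniq s -> x \in s -> 1 < size s -> next s x != x.
Proof.
move=> us xs sz; have [i s' es] := rot_to xs.
rewrite -(next_rot i us) es; move: us sz; rewrite -(rot_uniq i) -(size_rot i) es.
case: s' {es} => //= y s' /andP[]; rewrite finset.inE negb_or => /andP[xy _] _ _.
by rewrite eqxx eq_sym.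
Qed.

Lemma next_next_neq (T : eqType) (s : seq T) x :
  uniq s -> x \in s -> 2 < size s -> next s (next s x) != x.
Proof.
move=> us xs sz; have [i s' es] := rot_to xs.
rewrite -!(next_rot i us) es; move: us sz; rewrite -(rot_uniq i) -(size_rot i) es.
case: s' {es} => [|y [|z s']] //= /andP[]; rewrite !finset.inE !negb_or => /and3P[xy xz _] _ _.
by rewrite !eqxx (eq_sym y x) (negbTE xy) eq_sym.
Qed.

Section Discharging.
Variables (T : finType) (e : rel T) (rot : T -> seq T) (l : T -> nat).
Hypotheses (e_sym : symmetric e) (e_irr : irreflexive e).
Hypothesis rotP : rotation e rot.

Definition deg v := #|e v|.

(** The set U of the reducible configuration at v. *)
Definition tri v :=
  [set u | [&& e v u, deg u == 3 & [forall w, e u w ==> (w == v) || e v w]]]%SET.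

(** These hold for the list sizes of a minimal counterexample. The bound 12 comes from a union of
    size at least 11 and a common color. *)
Hypothesis l_deg : forall v, 3 <= l v <= deg v.
Hypothesis l_edge : forall u v, e u v -> 12 <= l u + l v.
Hypothesis l_tri : forall v, deg v <= 10 -> #|tri v| + l v <= deg v.

Local Notation phi := (face_map rot).
Local Notation D := (darts e).

Lemma size_rotation v : size (rot v) = deg v.
Proof.
have [u m] := rotP v; rewrite -(card_uniqP u); apply: eq_card => w.
by rewrite m.
Qed.

(* Faces have at least three sides, so that the face of x has at least four. *)
Definition big_face x := iter 3 phi x != x.

Lemma big_face_phi x : big_face (phi x) = big_face x.
Proof. by rewrite /big_face -iterSr iterS (inj_eq (face_map_inj rotP)). Qed.

Lemma deg3 v : 2 < deg v.
Proof. by have /andP[h1 h2] := l_deg v; apply: leq_trans h2. Qed.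

Lemma mem_rot u v : (v \in rot u) = e u v.
Proof. exact: (rotP u).2. Qed.

(** An orbit of length 1 would be a loop, and one of length 2 would need a vertex of degree 1. *)
Lemma face_order x : D x -> 2 + big_face x < order phi x.
Proof.
move=> Dx; have := iter_order (face_map_inj rotP) x; have := order_gt0 phi x.
case: x Dx => a b /= eab.
case: (order phi (a, b)) => [//|[|[|[|n]]]] _ //=.
- by case=> h; rewrite h e_irr in eab.
- case=> h _; have := @next_neq _ (rot b) a; rewrite h (rotP b).1 mem_rot e_sym eab eqxx.
  by rewrite size_rotation (ltn_trans _ (deg3 b)) // => /(_ isT isT isT).
- by move=> h; rewrite /big_face /= h eqxx.
- by case: big_face.
Qed.

(* A triangle receives 60 = 3 * 20, and any other face at least 60 = 4 * 15. *)
Lemma face_count :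
  60 * fcard phi D + 5 * \sum_(x | D x) big_face x <= 20 * #|D|.
Proof.
(* Each side brings 20 to its face and, unless the face is a triangle, pays out 5. *)
pose c x := 20 - 5 * big_face x.
have sumc : \sum_(x | D x) c x + 5 * \sum_(x | D x) big_face x = 20 * #|D|.
  rewrite big_distrr -big_split /= mulnC -sum_nat_const.
  by apply: eq_bigr => x _; rewrite /c; case: big_face.
suff : 60 * fcard phi D <= \sum_(x | D x) c x by lia.
pose Q r := (r \in froots phi) && D r.
have sy := fconnect_sym (face_map_inj rotP).
have cl : fclosed phi D.
  by move=> a b /eqP <-; rewrite -!topredE /= -[LHS]/(D a) -(face_map_dart e_sym rotP).
have Dr x : D (froot phi x) = D x.
  by have := closed_connect cl (connect_root _ x); rewrite -!topredE /= => <-.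
rewrite (partition_big (froot phi) Q) /=; last first.
  by move=> x Dx; rewrite /Q Dr; apply/andP; split=> //; apply: (roots_root sy).
rewrite mulnC -sum_nat_const.
rewrite (eq_bigl Q); last by move=> r; rewrite /Q finset.inE.
apply: leq_sum => r /andP[rr Dr'].
rewrite (eq_bigr (fun=> c r)); last first.
  move=> x /andP[_ /eqP h]; rewrite /c; congr (20 - 5 * _); congr nat_of_bool.
  have : fconnect phi x r by rewrite -h connect_root.
  apply: (fconnect_invariant (f := phi)) => y /=.
  by rewrite big_face_phi eqxx.
rewrite sum_nat_const.
have -> : #|[pred x | D x & froot phi x == r]| = order phi r.
  apply: eq_card => x; rewrite !finset.inE.
  have -> : (froot phi x == r) = fconnect phi r x.
    by rewrite sy -(root_connect sy) (eqP rr).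
  case h : (fconnect phi r x); last by rewrite andbF.
  by have := closed_connect cl h; rewrite -!topredE /= andbT => <-.
have := face_order Dr'; rewrite /c; case: big_face => /=; lia.
Qed.

Definition small u := deg u <= 5.

Lemma small_nbr u v : e u v -> small u -> 6 < deg v.
Proof.
rewrite /small => uv su; have := l_edge uv; have := l_deg u; have := l_deg v; lia.
Qed.

Lemma small_faceR u v : e u v -> small u -> ~~ big_face (u, v) ->
  e u (next (rot v) u).
Proof.
move=> uv su; rewrite negbK /= => /eqP[h1 h2]; move: h1 h2.
set w := next (rot v) u => h _.
have : v \in rot w by rewrite mem_rot e_sym -mem_rot mem_next mem_rot e_sym.
by rewrite -mem_next h mem_rot e_sym.
Qed.

Lemma small_faceL u v : e v u -> small u -> ~~ big_face (v, u) ->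
  e u (prev (rot v) u).
Proof.
move=> vu su; rewrite negbK /= => /eqP[h1 h2]; move: h1 h2.
set a := next (rot u) v => h; rewrite h => h'.
by rewrite -{2}h' prev_next ?(rotP v).1 // -mem_rot mem_next mem_rot e_sym.
Qed.

Definition smalls v := [set u | e v u & small u]%SET.
Definition larges v := [set u | e v u & ~~ small u]%SET.

Lemma card_smalls v : #|smalls v| + #|larges v| = deg v.
Proof.
rewrite /deg -(cardID (mem [pred u | small u]) (e v)).
by congr (_ + _); apply: eq_card => u; rewrite !finset.inE // andbC.
Qed.

(** The third vertex of a triangle on vu is adjacent to u, hence large, and it is the predecessor or
    successor of u around v. So each large neighbor is counted at most twice. *)
Lemma small_faces v :
  \sum_(u in smalls v) (~~ big_face (v, u) + ~~ big_face (u, v)) <= 2 * #|larges v|.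
Proof.
rewrite big_split mul2n -addnn /=.
have aux (p : pred T) (f : T -> T) : injective f ->
    (forall u, u \in smalls v -> p u -> e v (f u) /\ e u (f u)) ->
    \sum_(u in smalls v) p u <= #|larges v|.
  move=> inj_f H; rewrite -big_mkcondr /= sum1_card -(card_imset _ inj_f).
  apply/subset_leq_card/fintype.subsetP => w /imsetP[u /andP[us pu] ->].
  have [h1 h2] := H u us pu; rewrite finset.inE h1 /small -ltnNge.
  by rewrite finset.inE in us; case/andP: us => _ su; apply: leq_trans (small_nbr h2 su).
apply: leq_add.
- apply: (aux _ (prev (rot v))); first exact: can_inj (next_prev (rotP v).1).
  move=> u; rewrite finset.inE => /andP[vu su] h.
  by rewrite -mem_rot mem_prev mem_rot vu small_faceL.
- apply: (aux _ (next (rot v))); first exact: can_inj (prev_next (rotP v).1).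
  move=> u; rewrite finset.inE => /andP[vu su] h.
  by rewrite -mem_rot mem_next mem_rot vu small_faceR // e_sym.
Qed.

(** The predecessor and the successor of u around v are distinct and adjacent to u, so with v they
    are all the neighbors of u. *)
Lemma small_tri v u : e v u -> deg u = 3 ->
  ~~ big_face (v, u) -> ~~ big_face (u, v) -> u \in tri v.
Proof.
move=> vu du f1 f2; have su : small u by rewrite /small du.
have uv : e u v by rewrite e_sym.
set a := prev (rot v) u; set b := next (rot v) u.
have ea : e u a := small_faceL vu su f1.
have eb : e u b := small_faceR uv su f2.
have va : e v a by rewrite -mem_rot mem_prev mem_rot.
have vb : e v b by rewrite -mem_rot mem_next mem_rot.
have ab : a != b.
  apply/eqP => h; have : next (rot v) (next (rot v) u) = u.
    by rewrite -/b -h next_prev // (rotP v).1.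
  apply/eqP/next_next_neq; rewrite ?(rotP v).1 ?mem_rot ?size_rotation //; exact: deg3.
rewrite finset.inE vu du eqxx; apply/forallP => w; apply/implyP => uw.
case: eqP => //= /eqP wv; case: (eqVneq w a) => [->//|wa]; case: (eqVneq w b) => [->//|wb].
have : uniq [:: v; a; b; w].
  rewrite /= !finset.inE !negb_or ab (eq_sym v w) wv (eq_sym a w) wa (eq_sym b w) wb !andbT.
  by apply/andP; split; [move: va|move: vb]; apply: contraTneq => <-; rewrite e_irr.
move=> /card_uniqP => h; have : #|[:: v; a; b; w]| <= deg u.
  apply/subset_leq_card/fintype.subsetP => t; rewrite !finset.inE.
  by case/or4P => /eqP->.
by rewrite h du.
Qed.

(* Charges are multiplied by 10. *)
Definition gift v := if deg v == 3 then 10 else if deg v == 4 then 5 else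
  if deg v == 5 then 2 else 0.

Lemma vertex_charge v :
  60 + \sum_(u in smalls v) gift u <=
  10 * deg v + 5 * \sum_(u in smalls v) (big_face (v, u) + big_face (u, v))
  + gift v * deg v.
Proof.
(* [G] is what v pays. [Q] and [Ts] count the sides of edges from v to small vertices that lie in
   big faces and in triangles. *)
set G := \sum_(u in _) gift u; set Q := \sum_(u in _) _.
set Ts := \sum_(u in smalls v) (~~ big_face (v, u) + ~~ big_face (u, v)).
have Tle : Ts <= 2 * #|larges v| := small_faces v.
have cs := card_smalls v.
have sumc (k : nat) : \sum_(u in smalls v) k = k * #|smalls v|.
  by rewrite sum_nat_const mulnC.
have QT : Q + Ts = 2 * #|smalls v|.
  by rewrite -big_split -sumc; apply: eq_bigr => u _ /=; do 2 case: big_face.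
have lv := l_deg v.
have sm u : u \in smalls v -> [/\ e v u, 3 <= deg u <= 5 & 12 <= l u + l v].
  rewrite finset.inE => /andP[vu su]; rewrite e_sym in vu; split; rewrite 1?e_sym ?deg3 //.
  exact: l_edge.
have lu u := l_deg u.
have gc u : 3 <= deg u <= 5 ->
    [\/ deg u = 3 /\ gift u = 10, deg u = 4 /\ gift u = 5 | deg u = 5 /\ gift u = 2].
  rewrite /gift; case: (deg u) => [|[|[|[|[|[|n]]]]]] //= _; by [left|right|constructor 2|constructor 3|constructor 1].
have G10 : G <= 10 * #|smalls v|.
  by rewrite -sumc; apply: leq_sum => u /sm[_ /gc[] [_ ->]].
(* A small vertex pays nothing and receives enough: 30 + 30 = 40 + 20 = 50 + 10 = 60. *)
case: (leqP (deg v) 5) => [sv|bv].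
  have s0 : #|smalls v| = 0.
    apply/eqP; rewrite cards_eq0 -finset.subset0; apply/fintype.subsetP => u /[dup] /sm[vu _ _].
    by rewrite finset.inE => /andP[_ su]; have := small_nbr vu sv; rewrite ltnNge (leq_trans su).
  have : 3 <= deg v <= 5 by rewrite deg3.
  by move/gc => [] [-> ->]; lia.
(* From degree 11 on, v has 6 large neighbors, which save 10 each, or 6 small ones; the latter
   suffice since [Q] is at least twice the excess of small over large neighbors. *)
case: (leqP (deg v) 10) => [dv|dv]; last by lia.
have tv := l_tri dv.
(* A gift above 5 is compensated by a big face, except for the members of [tri v]. *)
have G5t : G <= 5 * Q + 5 * #|smalls v| + 5 * #|tri v|.
  rewrite -sumc -[X in _ + 5 * X]sum1_card.
  have : \sum_(u in smalls v) (u \in tri v) <= \sum_(u in tri v) 1.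
    rewrite -big_mkcondr /= !sum1_card.
    by apply/subset_leq_card/fintype.subsetP => u /andP[_].
  suff : G <= 5 * Q + \sum_(u in smalls v) 5 + 5 * \sum_(u in smalls v) (u \in tri v) by lia.
  rewrite !big_distrr -!big_split /=; apply: leq_sum => u /sm[vu /gc[] [du ->] _]; try lia.
  case: (boolP (big_face (v, u))) => f1; first by lia.
  case: (boolP (big_face (u, v))) => f2; first by lia.
  by rewrite small_tri.
(* With [l_tri], [tri v] is empty at degree 9 and has at most one member at degree 10. *)
have t9 : 0 < #|tri v| -> 9 <= l v.
  move=> /card_gt0P[u]; rewrite finset.inE => /and3P[/l_edge h /eqP du _].
  by have := lu u; lia.
case: (leqP (deg v) 8) => [d8|d8]; last by lia.
(* Now [l v] is at most 8, so no neighbor has degree 3. *)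
have G5 : G <= 5 * #|smalls v|.
  rewrite -sumc; apply: leq_sum => u /sm[vu /gc[] [du ->] h] //.
  by have := lu u; lia.
have GT : 2 * G <= 10 * Q + 5 * Ts.
  rewrite !big_distrr -!big_split /=; apply: leq_sum => u /sm[vu /gc[] [du ->] h];
  have := lu u; do 2 case: big_face => /=; lia.
case: (leqP (deg v) 7) => [d7|d7]; last by lia.
(* At degree 7 the small neighbors have degree 5, and at degree 6 there are none. *)
have G2 : G <= 2 * #|smalls v|.
  rewrite -sumc; apply: leq_sum => u /sm[vu /gc[] [du ->] h] //; have := lu u; lia.
have GT2 : G <= 5 * Q + Ts.
  rewrite !big_distrr -!big_split /=; apply: leq_sum => u /sm[vu /gc[] [du ->] h];
  have := lu u; do 2 case: big_face => /=; lia.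
case: (leqP (deg v) 6) => [d6|d6]; last by lia.
have s0 : #|smalls v| = 0.
  apply/eqP; rewrite cards_eq0 -finset.subset0; apply/fintype.subsetP => u /sm[vu h1 h2].
  by have := lu u; lia.
lia.
Qed.

Lemma discharging : face_labels e rot -> #|T| = 0.
Proof.
move=> labels; apply/eqP; rewrite -leqn0 leqNgt; apply/negP => T0.
have eu := euler e_sym e_irr rotP labels T0.
have fc := face_count.
have sumD (f : T -> T -> nat) : \sum_(x | D x) f x.1 x.2 = \sum_v \sum_(u | e v u) f v u.
  by rewrite pair_big_dep.
have cardD : #|D| = \sum_v deg v.
  rewrite -sum1_card (sumD (fun _ _ => 1)); apply: eq_bigr => v _.
  by rewrite sum1_card.
have sumS (f : T -> T -> nat) v :
    \sum_(u in smalls v) f v u = \sum_(u | e v u) small u * f v u.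
  rewrite [RHS](bigID small) /= [X in _ = _ + X]big1 ?addn0; last by move=> u /andP[_ /negbTE->].
  apply: eq_big => [u|u]; rewrite finset.inE // => /andP[_ ->]; by rewrite mul1n.
have : \sum_v (60 + \sum_(u in smalls v) gift u) <=
    \sum_v (10 * deg v + 5 * \sum_(u in smalls v) (big_face (v, u) + big_face (u, v))
             + gift v * deg v).
  by apply: leq_sum => v _; exact: vertex_charge.
rewrite 3!big_split /= sum_nat_const (_ : #|_| = #|T|) //.
have dist (k : nat) (f : T -> nat) : \sum_v k * f v = k * \sum_v f v by rewrite big_distrr.
rewrite !dist -cardD.
(* What the vertices pay equals what the small ones receive. *)
have -> : \sum_v \sum_(u in smalls v) gift u = \sum_v gift v * deg v.
  under eq_bigr do rewrite (sumS (fun _ u => gift u)).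
  have gs u : small u * gift u = gift u.
    by rewrite /gift /small; case: (deg u) => [|[|[|[|[|[|n]]]]]].
  under eq_bigr do under eq_bigr do rewrite gs.
  under eq_bigr do rewrite big_mkcond /=.
  rewrite exchange_big; apply: eq_bigr => u _.
  rewrite -big_mkcond /= sum_nat_const mulnC; congr (_ * _).
  by apply: eq_card => v; rewrite -!topredE /= e_sym.
(* Small vertices are not adjacent, so each dart pays at most once. *)
have : \sum_v \sum_(u in smalls v) (big_face (v, u) + big_face (u, v)) <=
    \sum_(x | D x) big_face x.
  under eq_bigr do rewrite (sumS (fun v u => big_face (v, u) + big_face (u, v))).
  under eq_bigr do under eq_bigr do rewrite mulnDr.
  under eq_bigr do rewrite big_split /=.
  rewrite big_split /=.
  have -> : \sum_v \sum_(u | e v u) small u * big_face (u, v) =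
            \sum_v \sum_(u | e v u) small v * big_face (v, u).
    under eq_bigr do rewrite big_mkcond /=.
    rewrite exchange_big; apply: eq_bigr => u _; rewrite -big_mkcond /=.
    by apply: eq_bigl => v; rewrite e_sym.
  rewrite -!sumD -big_split /=; apply: leq_sum => -[u v] /= uv.
  case su : (small u); case sv : (small v); case: big_face => //=.
  by have := small_nbr uv su; rewrite ltnNge (leq_trans sv).
lia.
Qed.

End Discharging.

(** * List colorings *)

(** This serves for induced subgraphs and, with [f] the identity, for deleting edges. *)
Lemma planar_embed (R : realType) (S T : finType) (f : S -> T) (e : rel T) (e' : rel S) :
  injective f -> (forall x y, e' x y -> e (f x) (f y)) -> planar R e -> planar R e'.
Proof.
move=> f_inj sub [pos [arc [pos_inj simple rv vert meet]]].
exists (pos \o f), (fun x y => arc (f x) (f y)); split.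
- by move=> x y /pos_inj/f_inj.
- by move=> u v /sub; exact: simple.
- by move=> u v /sub; exact: rv.
- by move=> u v w /sub uv /(vert _ _ _ uv) [] /f_inj; auto.
move=> u v x y z /sub uv /sub xy ne zu zx.
have ne' : [set f u; f v]%SET != [set f x; f y]%SET.
  apply: contraNneq ne => h; apply/eqP/finset.setP => t.
  have : (f t \in [set f u; f v]%SET) = (f t \in [set f x; f y]%SET) by rewrite h.
  by rewrite !finset.inE !(inj_eq f_inj).
have [w zw] := meet _ _ _ _ _ uv xy ne' zu zx.
rewrite !finset.inE => /andP[/orP wuv wxy].
have [w' ew] : exists w', w = f w' by case: wuv => /eqP ->; [exists u|exists v].
exists w'; first by rewrite zw ew.
by rewrite !finset.inE -!(inj_eq f_inj) -ew wxy andbT; apply/orP.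
Qed.

Definition seq_coloring (T : finType) (e : rel T) (K : eqType) (lst : T -> seq K)
    (B : {set T}) (c : T -> K) :=
  (forall v, v \in B -> c v \in lst v) /\
  (forall u v, u \in B -> v \in B -> e u v -> c u != c v).

Lemma leq_size_minus (K : eqType) (s t : seq K) :
  size (undup (s ++ t)) <= size t + size [seq k <- s | k \notin t].
Proof.
rewrite addnC -size_cat; apply: uniq_leq_size; first exact: undup_uniq.
move=> k; rewrite mem_undup !mem_cat mem_filter; by case: (k \in t); rewrite ?orbT // !orbF.
Qed.

(** * Reducible configurations *)

Section Extension.
Variables (T : finType) (e : rel T) (K : eqType) (lst : T -> seq K).
Hypotheses (e_sym : symmetric e) (e_irr : irreflexive e).
Hypothesis lst_uniq : forall v, uniq (lst v).
Hypothesis lst_size : forall v, 3 <= size (lst v).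
Hypothesis lst_union : forall u v, e u v -> 11 <= size (undup (lst u ++ lst v)).

(** With U empty this excludes vertices of degree less than the list size; with U = [tri e v] it
    yields [l_tri]. *)
Lemma seq_coloring_extend (v : T) (U : {set T}) (c : T -> K) :
  (forall u, u \in U -> e v u /\ deg e u <= 3) ->
  (forall u w, u \in U -> e u w -> w = v \/ (e v w /\ w \notin U)) ->
  deg e v < #|U| + size (lst v) ->
  (U != finset.set0 -> deg e v <= 10) ->
  seq_coloring e lst (~: (v |: U))%SET c ->
  exists c', seq_coloring e lst [set: T]%SET c'.
Proof.
move=> Uv Uw dv d10 [cl cc].
have vU : v \notin U by apply/negP => /Uv[]; rewrite e_irr.
pose N := [set w | e v w & w \notin U]%SET.
have cN : #|N| + #|U| = deg e v.
  rewrite addnC /deg -(cardID (mem U) (e v)); congr (_ + _).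
    apply: eq_card => w; rewrite !finset.inE; case wU: (w \in U); rewrite ?andbF //.
    by rewrite -[w \in e v]/(e v w) andbT; have [-> _] := Uv w wU.
  by apply: eq_card => w; rewrite !finset.inE andbC.
have memB x : (x \in (~: (v |: U))%SET) = (x != v) && (x \notin U).
  by rewrite finset.in_setC finset.in_setU1 negb_or.
pose rest u := [seq k <- lst u | k \notin [seq c w | w in [set w | e u w & w != v]%SET]].
have rest0 u : u \in U -> 0 < size (rest u).
  move=> uU; have [vu du] := Uv u uU; have := lst_size u.
  pose M := [set w | e u w & w != v]%SET.
  have cM : #|M| < 3.
    apply: leq_trans du; apply/proper_card/properP; split.
      by apply/fintype.subsetP => w; rewrite finset.inE => /andP[].
    by exists v; [rewrite -topredE /= e_sym|rewrite finset.inE eqxx andbF].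
  have : size (lst u) <= size (rest u ++ [seq c w | w in M]).
    apply: uniq_leq_size => // k kl; rewrite mem_cat mem_filter kl andbT.
    by case: (k \in _).
  rewrite size_cat size_image; lia.
(* The neighbors in [O] do no harm to v; only those in [I] remove colors from its list. *)
pose O := [set w in N | c w \notin lst v]%SET.
pose I := [set w in N | c w \in lst v]%SET.
have cIO : #|I| + #|O| = #|N|.
  rewrite -(cardID [pred w | c w \in lst v] N); congr (_ + _);
  by apply: eq_card => w; rewrite !finset.inE // andbC.
pose avail := [seq k <- lst v | k \notin [seq c w | w in N]].
have av : size (lst v) <= size avail + #|I|.
  rewrite -(size_image c I) -size_cat; apply: uniq_leq_size => // k kl.
  rewrite mem_cat mem_filter kl andbT; case: fintype.imageP => //= -[w wN ek].
  by apply/fintype.imageP; exists w => //; rewrite inE wN -ek.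
(* The vertices of U that forbid their only remaining color to v. *)
pose tight := [set u in U | (size (rest u) == 1) && has (mem (lst v)) (rest u)]%SET.
pose blocked := flatten [seq rest u | u in tight].
have sb : size blocked <= #|U|.
  rewrite /blocked size_flatten /shape -map_comp.
  rewrite (eq_in_map _ (fun=> 1) _).1; last first.
    by move=> u; rewrite mem_enum inE => /andP[_ /andP[/eqP]].
  have -> : sumn [seq 1 | _ <- enum tight] = #|tight|.
    by rewrite cardE; elim: (enum _) => //= a s ->.
  by apply/subset_leq_card/fintype.subsetP => u; rewrite inE => /andP[].
have lt : size blocked < size avail.
  case: (set_0Vmem tight) => [t0|[u]].
    have -> : size blocked = 0 by rewrite /blocked t0 /image_mem enum_set0.
    lia.
  rewrite inE => /andP[uU /andP[/eqP s1 /hasP[k kr kv]]].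
  have [vu _] := Uv u uU; have uv : e u v by rewrite e_sym.
  have U0 : U != finset.set0 by apply/finset.set0Pn; exists u.
  have := d10 U0; have := lst_union uv; have := leq_size_minus (lst u) (lst v).
  (* The only color left at u lies in [lst v], so all colors of u outside [lst v] are used on
     neighbors of u, which are in [N]. *)
  have : size [seq k <- lst u | k \notin lst v] <= #|O|.
    rewrite -(size_image c O); apply: uniq_leq_size; first exact: filter_uniq.
    move=> k'; rewrite mem_filter => /andP[k'v k'u].
    have kk : k' != k by apply: contraNneq k'v => ->.
    have : k' \notin rest u.
      by move: s1 kr; case: (rest u) => [|a [|]] //= _; rewrite !mem_seq1 => /eqP <-.
    rewrite mem_filter k'u andbT negbK => /fintype.imageP[w]; rewrite inE => /andP[uw wv] ek.
    apply/fintype.imageP; exists w => //; rewrite !finset.inE -ek k'v andbT.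
    by case: (Uw u w uU uw) => [ew|[-> ->]] //; rewrite ew eqxx in wv.
  lia.
have [k ka kb] : exists2 k, k \in avail & k \notin blocked.
  case: (altP (@allP _ (mem blocked) avail)) => [h|/allPn//].
  have := uniq_leq_size (filter_uniq _ (lst_uniq v)) h; by rewrite leqNgt lt.
move: ka; rewrite mem_filter => /andP[kN kv].
(* Otherwise k is the only color left at u, so u is tight and k is blocked. *)
have rk u : u \in U -> has (predC1 k) (rest u).
  move=> uU; apply: contraNT kb; rewrite has_predC negbK => /allP al.
  have ru := filter_uniq (fun k => k \notin [seq c w | w in [set w | e u w & w != v]%SET]) (lst_uniq u).
  have re : rest u = [:: k].
    have := rest0 u uU; move: ru al; rewrite -/(rest u).
    case: (rest u) => // a s /= /andP[as' us] al _.
    have ea : a = k by apply/eqP/al; rewrite mem_head.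
    case: s as' us al => [|b s]; first by rewrite ea.
    rewrite inE negb_or => /andP[ab _] _ /(_ b); rewrite !inE eqxx orbT => /(_ isT) /eqP eb.
    by rewrite ea eb eqxx in ab.
  apply/flattenP; exists (rest u); last by rewrite re mem_head.
  by apply/fintype.imageP; exists u => //; rewrite inE uU re /= kv.
pose c' x := if x == v then k else if x \in U then nth k (rest x) (find (predC1 k) (rest x)) else c x.
have c'v : c' v = k by rewrite /c' eqxx.
have c'U u : u \in U -> c' u \in rest u /\ c' u != k.
  move=> uU; rewrite /c' uU; case: eqP => [ev|_]; first by rewrite -ev uU in vU.
  by split; [rewrite mem_nth // -has_find rk|apply: (nth_find k (rk u uU))].
have c'B x : x != v -> x \notin U -> c' x = c x by rewrite /c' => /negbTE-> /negbTE->.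
exists c'; split=> [x _|x y _ _ xy].
  case: (eqVneq x v) => [->|xv]; first by rewrite c'v.
  case: (boolP (x \in U)) => xU.
    by have [] := c'U x xU; rewrite mem_filter => /andP[].
  by rewrite c'B // cl // memB xv.
have key a b : e a b -> (a == v) || (a \in U) -> c' a != c' b.
  move=> ab; case: (eqVneq a v) => [ea _|nav /= aU].
    subst a; rewrite c'v; case: (boolP (b \in U)) => bU; first by rewrite eq_sym; case: (c'U b bU).
    have bv : b != v by apply: contraTneq ab => ->; rewrite e_irr.
    rewrite c'B //; apply: contraNneq kN => ->; apply/fintype.imageP; exists b => //.
    by rewrite inE ab.
  have [ar ak] := c'U a aU; case: (Uw a b aU ab) => [->|[vb bU]]; first by rewrite c'v.
  have bv : b != v by apply: contraTneq vb => ->; rewrite e_irr.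
  rewrite (c'B b) //; move: ar; rewrite mem_filter => /andP[+ _]; apply: contraNneq => ->.
  by apply/fintype.imageP; exists b => //; rewrite inE ab.
case: (boolP ((x == v) || (x \in U))) => hx; first exact: key.
case: (boolP ((y == v) || (y \in U))) => hy; first by rewrite eq_sym key // e_sym.
move: hx hy; rewrite !negb_or => /andP[xv xU] /andP[yv yU].
by rewrite !c'B // cc // memB ?xv ?yv.
Qed.

End Extension.

Lemma planar_seq_coloring (R : realType) (T : finType) (e : rel T) (K : eqType) (lst : T -> seq K) :
  symmetric e -> irreflexive e -> planar R e ->
  (forall v, uniq (lst v)) -> (forall v, 3 <= size (lst v)) ->
  (forall u v, e u v -> 11 <= size (undup (lst u ++ lst v))) ->
  (forall u v, e u v -> has (mem (lst u)) (lst v)) ->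
  exists c, seq_coloring e lst [set: T]%SET c.
Proof.
have [n] := ubnP #|T|; elim: n T e lst => // n IH T e lst.
rewrite ltnS => cT e_sym e_irr pl lu ls lun lc.
case: (pselect (exists c, seq_coloring e lst [set: T]%SET c)) => // nc; exfalso.
(* Induction applies to the subgraph induced on the proper subset B. *)
have partial (B : {set T}) v : v \notin B -> exists c, seq_coloring e lst B c.
  move=> vB; pose S := {x : T | x \in B}.
  pose e' (x y : S) := e (val x) (val y).
  have [||||x|x|x y|x y|c [c1 c2]] := IH S e' (lst \o val).
  - rewrite card_sig; apply: leq_trans cT; apply/proper_card/properP.
    by split; [apply/fintype.subsetP|exists v].
  - by move=> x y; exact: e_sym.
  - by move=> x; exact: e_irr.
  - exact: planar_embed val_inj _ pl.
  - exact: lu.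
  - exact: ls.
  - exact: lun.
  - exact: lc.
  have k0 : K by case: (lst v) (ls v).
  exists (fun x => if insub x is Some y then c y else k0); split=> [x xB|x y xB yB].
    by rewrite (insubT (mem B) xB) /=; apply: c1; rewrite inE.
  rewrite (insubT (mem B) xB) (insubT (mem B) yB) /= => xy.
  by apply: c2; rewrite ?inE.
have ext (v : T) (U : {set T}) :
    (forall u, u \in U -> e v u /\ deg e u <= 3) ->
    (forall u w, u \in U -> e u w -> w = v \/ (e v w /\ w \notin U)) ->
    deg e v < #|U| + size (lst v) -> (U != finset.set0 -> deg e v <= 10) -> False.
  move=> h1 h2 h3 h4; have vB : v \notin (~: (v |: U))%SET.
    by rewrite finset.in_setC finset.in_setU1 eqxx.
  have [c hc] := partial _ _ vB.
  exact: nc (seq_coloring_extend e_sym e_irr lu ls lun h1 h2 h3 h4 hc).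
have l_deg v : 3 <= size (lst v) <= deg e v.
  rewrite ls leqNgt; apply/negP => h; apply: (ext v finset.set0); rewrite ?cards0 //.
  - by move=> u; rewrite finset.in_set0.
  - by move=> u w; rewrite finset.in_set0.
  - by rewrite eqxx.
have l_edge u v : e u v -> 12 <= size (lst u) + size (lst v).
  move=> uv; have := lun u v uv; have := leq_size_minus (lst u) (lst v).
  suff : size [seq k <- lst u | k \notin lst v] < size (lst u) by lia.
  rewrite size_filter -[X in _ < X](count_predC (mem (lst v))) addnC -[X in X < _]addn0.
  rewrite ltn_add2l -has_count; have /hasP[k ku kv] := lc u v uv.
  by apply/hasP; exists k.
have l_tri v : deg e v <= 10 -> #|tri e v| + size (lst v) <= deg e v.
  move=> d10; rewrite leqNgt; apply/negP => h; apply: (ext v (tri e v)) => //.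
    by move=> u; rewrite finset.inE => /and3P[-> /eqP -> _].
  move=> u w; rewrite finset.inE => /and3P[vu /eqP du /forallP al] uw.
  have := al w; rewrite uw /= => /orP[/eqP->|vw]; [by left|right; split=> //].
  (* Two adjacent vertices of degree 3 would have lists of total size at most 6. *)
  have := l_edge u w uw; have := l_deg u; have := l_deg w.
  by rewrite finset.inE vw /= du; case: eqP => //= ->; lia.
have [rot [rotP labels]] := planar_face_labels e_sym e_irr pl.
have T0 := discharging e_sym e_irr rotP l_deg l_edge l_tri labels.
apply: nc; have noT (x : T) : False by have := fintype0 x; rewrite T0.
have k0 : T -> K by move=> x; case: (noT x).
by exists k0; split=> x; case: (noT x).
Qed.

(** * From arbitrary lists to finite ones *)

Lemma card_le_seq (C : Type) (A : set C) n : (`I_n #<= A)%card ->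
  exists s : seq {classic C}, [/\ uniq s, size s = n & forall k, k \in s -> A k].
Proof.
move=> /card_leP [f]; pose g (i : 'I_n) : set_type `I_n :=
  @SigSub _ _ _ (nat_of_ord i) (mem_set (ltn_ord i : `I_n (nat_of_ord i))).
exists [seq (val (f (g i)) : {classic C}) | i <- enum 'I_n]; split.
- rewrite map_inj_uniq ?enum_uniq // => i j /val_inj h.
  have : g i = g j by apply: 'inj_f; rewrite ?in_setT.
  by move=> [/val_inj].
- by rewrite size_map size_enum_ord.
- by move=> k /mapP[i _ ->]; exact: set_valP.
Qed.

Lemma truncate_list (C : Type) (A : set C) n :
  exists s : seq {classic C}, [/\ uniq s, forall k, k \in s -> A k &
    size s = n \/ forall k : {classic C}, A k -> k \in s].
Proof.
elim: n => [|n [s [us sA [sn|al]]]]; first by exists [::]; split; auto.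
  case: (pselect (forall k : {classic C}, A k -> k \in s)) => [al|].
    by exists s; split; auto.
  move=> /existsNP[k /not_implyP[Ak /negP ks]].
  exists (k :: s); split; [by rewrite /= ks| |by left; rewrite /= sn].
  by move=> k'; rewrite inE => /orP[/eqP->|/sA].
by exists s; split; auto.
Qed.

Theorem theorem2 (R : realType) (T : finType) (e : rel T)
    (e_sym : symmetric e) (e_irr : irreflexive e) (e_planar : planar R e) :
  choosable 3 11 e.
Proof.
move=> C L [L3 L11].
(* A truncated list has 11 colors and meets the union bound alone; the other lists are kept
   whole. *)
have [lst lstP] := choice (fun v => truncate_list (L v) 11).
have lu v : uniq (lst v) by case: (lstP v).
have lL v k : k \in lst v -> L v k by case: (lstP v) => _ h _; exact: h.
have l3 v : 3 <= size (lst v).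
  case: (lstP v) => _ _ [->//|al].
  have [s [us <- sA]] := card_le_seq (L3 v).
  by apply: uniq_leq_size => // k /sA/al.
have l11 u v : e u v -> 11 <= size (undup (lst u ++ lst v)).
  move=> uv; have sub w : {subset lst w <= lst u ++ lst v} ->
      size (lst w) <= size (undup (lst u ++ lst v)).
    by move=> h; apply: uniq_leq_size => // k /h; rewrite mem_undup.
  case: (lstP u) => _ _ [hu|hu].
    by rewrite -{1}hu sub // => k ku; rewrite mem_cat ku.
  case: (lstP v) => _ _ [hv|hv].
    by rewrite -{1}hv sub // => k kv; rewrite mem_cat kv orbT.
  have [s [us <- sA]] := card_le_seq (L11 u v uv).
  apply: uniq_leq_size => // k /sA; rewrite mem_undup mem_cat.
  by case=> [/hu ->//|/hv ->]; rewrite orbT.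
(* A coloring for [e'] is proper for [e]: equal colors at the ends of an edge would be common to
   both lists. *)
pose e' u v := e u v && has (mem (lst u)) (lst v).
have [c [c1 c2]] : exists c, seq_coloring e' lst [set: T]%SET c.
  apply: (@planar_seq_coloring R) => //.
  - by move=> u v; rewrite /e' e_sym has_sym.
  - by move=> u; rewrite /e' e_irr.
  - by apply: (planar_embed (f := id)) e_planar => // x y /andP[].
  - by move=> u v /andP[/l11].
  - by move=> u v /andP[].
exists c; split=> [v|u v uv]; first by apply/lL/c1; rewrite finset.inE.
have cu : c u \in lst u by apply: c1; rewrite finset.inE.
have cv : c v \in lst v by apply: c1; rewrite finset.inE.
move=> cuv; have : c u != c v.
  apply: c2; rewrite ?finset.inE // /e' uv; apply/hasP; exists (c v) => //=.
  by rewrite -cuv.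
by rewrite cuv eqxx.
Qed.
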